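(* Let $p\ge3$, $\beta>\beta_0>\beta^*(p)$ and $\delta\in(0,1)$. Then the conditions $c_{\hat{\beta}_{\mathrm{MPL}}}(\beta_0,\beta,p)=c_{\hat{\beta}_{\mathrm{ML}}}(\beta_0,\beta,p)$ and $N_{\hat{\beta}_{\mathrm{MPL}}}^*(\beta_0,\beta,\delta,p)=N_{\hat{\beta}_{\mathrm{ML}}}^*(\beta_0,\beta,\delta,p)$ are equivalent, and a necessary and sufficient condition for them to hold is $H_{\beta_0,p}(m_*(\beta,p))\ge0$.
   Context: **Model.** For an integer $p\ge2$ and $n\ge 1$, the $p$-tensor Curie-Weiss model with parameter $\beta$ is the probability mass function on $\{-1,1\}^n$ $$\mathbb{P}_{\beta,p}(x)=\frac{\exp\{\beta n^{1-p}\sum_{1\le i_1,\dots,i_p\le n}x_{i_1}\cdots x_{i_p}\}}{2^nZ_n(\beta,p)},$$ with $Z_n(\beta,p)$ the normalizing constant. $X=(X_1,\dots,X_n)$ denotes a sample from it and $\overline{X}_n=\frac1n\sum_{i=1}^nX_i$. **Functions and threshold.** For $x\in[-1,1]$ (with $0\log0=0$), $H_{\beta,p}(x)=\beta x^p-\tfrac12\{(1+x)\log(1+x)+(1-x)\log(1-x)\}$, and $\beta^*(p)=\sup\{\beta\ge0:\sup_{x\in[-1,1]}H_{\beta,p}(x)=0\}$. For $\beta>\beta^*(p)$, $m_*(\beta,p)\in(0,1)$ denotes the unique positive global maximizer of $H_{\beta,p}$. **Estimators.** $\hat{\beta}_{\mathrm{ML}}$ is the maximum likelihood estimator of $\beta$,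 i.e. the maximizer of $\beta\mapsto\mathbb{P}_{\beta,p}(X)$ (equal to $\pm\infty$ if the supremum is only approached at $\pm\infty$). The maximum pseudolikelihood estimator is given explicitly by $\hat{\beta}_{\mathrm{MPL}}=p^{-1}\overline{X}_n^{1-p}\tanh^{-1}(\overline{X}_n)$ if $\overline{X}_n\ne0$ and $0$ if $\overline{X}_n=0$ (extended-real valued when $\overline X_n=\pm1$). **Bahadur slope.** Consider testing $H_0:\beta=\beta_0$ versus $H_1:\beta>\beta_0$ with $\beta_0>\beta^*(p)$ using $T_n=\sqrt n(\hat\beta-\beta_0)$, where $\hat\beta$ is $\hat{\beta}_{\mathrm{ML}}$ or $\hat{\beta}_{\mathrm{MPL}}$, large values being significant. Let $F_{T_n,\beta_0}$ be the cumulative distribution function of $T_n$ under $\mathbb{P}_{\beta_0,p}$ and $L_n=1-F_{T_n,\beta_0}(T_n)$. The (weak) Bahadur slope of $\hat\beta$ at the alternative $\beta$ is the constant $c_{\hat\beta}(\beta_0,\beta,p)$ such that $\frac1n\log L_n\to-\frac12c_{\hat\beta}(\beta_0,\beta,p)$ in probability as $n\to\infty$ when $X\sim\mathbb{P}_{\beta,p}$. The asymptotic optimal sample size is $N^*_{\hat\beta}(\beta_0,\beta,\delta,p)=-2\log(\delta)/c_{\hat\beta}(\beta_0,\beta,p)$. *)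

(* Defs.v *)
(* Libraries: MathComp and MathComp-Analysis. *)
From mathcomp Require Import all_boot all_order all_algebra.
From mathcomp Require Import all_classical all_reals all_analysis.

Set Implicit Arguments.
Unset Strict Implicit.
Unset Printing Implicit Defensive.

Import Order.TTheory GRing.Theory Num.Theory.
Import numFieldNormedType.Exports.

Local Open Scope classical_set_scope.
Local Open Scope ring_scope.

(* {-1, 1}^n, with [true] standing for the spin 1 and [false] for -1. *)
Definition config (n : nat) := {ffun 'I_n -> bool}.

Section Model.
Context {R : realType}.
Implicit Types (p n : nat) (b c d : R).

Definition spin n (x : config n) (i : 'I_n) : R := if x i then 1 else -1.

Definition xbar n (x : config n) : R := (\sum_(i < n) spin x i) / n%:R.

(* n ^- (p - 1) is n^(1 - p); p >= 1 in all uses. *)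
Definition cw_hamiltonian p n (x : config n) : R :=
  n%:R ^- (p - 1) * \sum_(i : {ffun 'I_p -> 'I_n}) \prod_(k < p) spin x (i k).

Definition Zn b p n : R :=
  2 ^- n * \sum_(x : config n) expR (b * cw_hamiltonian p x).

Definition cw_pmf b p n (x : config n) : R :=
  expR (b * cw_hamiltonian p x) / (2 ^+ n * Zn b p n).

Definition cw_prob b p n (A : pred (config n)) : R := \sum_(x | A x) cw_pmf b p x.

(* The convention 0 log 0 = 0 is automatic since ln 0 = 0. *)
Definition H b p (x : R) : R :=
  b * x ^+ p - 2^-1 * ((1 + x) * ln (1 + x) + (1 - x) * ln (1 - x)).

Definition beta_star p : R :=
  sup [set b | 0 <= b /\ sup [set H b p x | x in `[-1, 1]%classic] = 0].

Definition m_star b p : R :=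
  xget 0 [set m | 0 < m < 1 /\ forall x, -1 <= x <= 1 -> H b p x <= H b p m].

Definition estimator := forall n, config n -> \bar R.

(* [b] is a maximizer over the whole real line of the likelihood at [x]; it is
   infinite only when the supremum is not attained and is approached there. *)
Definition is_mle p n (x : config n) (b : \bar R) : Prop :=
  let lik b' := cw_pmf b' p x in
  let attained_at r := forall b', lik b' <= lik r in
  match b with
  | r%:E => attained_at r
  | +oo%E => ~ (exists r, attained_at r) /\ lik r @[r --> +oo] --> sup (range lik)
  | -oo%E => ~ (exists r, attained_at r) /\ lik r @[r --> -oo] --> sup (range lik)
  end.

(* The choice made by [xget] matters only when the likelihood is constant, which
   for p >= 1 happens only if n = 0, or n = 1 and p is even. *)
Definition mle p : estimator := fun n x => xget 0%E (is_mle p x).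

Definition atanhe (x : R) : \bar R :=
  if x == 1 then +oo%E else if x == -1 then -oo%E
  else (2^-1 * ln ((1 + x) / (1 - x)))%:E.

Definition mple p : estimator := fun n x =>
  let m := xbar x in
  if m == 0 then 0%E else ((p%:R^-1 * m ^- (p - 1))%:E * atanhe m)%E.

Definition test_stat (est : estimator) b0 n (x : config n) : \bar R :=
  ((Num.sqrt n%:R)%:E * (est n x - b0%:E))%E.

Definition cw_cdf b p n (T : config n -> \bar R) (t : \bar R) : R :=
  cw_prob b p (fun y => T y <= t)%E.

Definition Ln (est : estimator) b0 p n (x : config n) : R :=
  1 - cw_cdf b0 p (test_stat est b0 (n:=n)) (test_stat est b0 x).

Definition cvg_in_prob b p (Y : estimator) c : Prop :=
  forall eps : R, 0 < eps ->
    cw_prob b p (fun x : config n => eps%:E < `|Y n x - c%:E|)%E @[n --> \oo] --> (0 : R).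

(* [lne] is the extended logarithm, with lne 0 = -oo. *)
Definition is_bahadur_slope (est : estimator) b0 b p c : Prop :=
  cvg_in_prob b p (fun n x => (n%:R^-1)%:E * lne (Ln est b0 p x)%:E)%E
    (- (2^-1 * c)).

Definition bahadur_slope (est : estimator) b0 b p : R :=
  xget 0 (is_bahadur_slope est b0 b p).

Definition opt_sample_size (est : estimator) b0 b d p : R :=
  - 2 * ln d / bahadur_slope est b0 b p.

End Model.

(* Main.v *)
Require Import Defs.
From mathcomp Require Import all_boot all_order all_algebra.
From mathcomp Require Import all_classical all_reals all_analysis.
From mathcomp Require Import ring lra.

(* Write m = m_star b and m0 = m_star b0.  A type-counting large deviation
   argument shows that, under [b0], an event of the form {xbar in B} has
   probability exp(n (sup_B H_b0 - H_b0(m0)) + o(n)), while under [b] the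
   magnetization concentrates at m (up to sign if p is even).
   The MLE is an increasing function of xbar^p, so beating the observed value
   means xbar > m, and the supremum of H_b0 there is H_b0(m).
   The MPLE is g(xbar) with g(x) = atanh(x) / (p x^(p-1)), which is strictly
   quasi-convex on (0, 1) and blows up at 0+ as well as at 1, so the event also
   contains a right neighbourhood of 0, where H_b0 is close to 0; there, and on
   the rest of the left branch, H_b0 <= 0.
   Hence c_ML = 2 (H_b0(m0) - H_b0(m)) and
   c_MPL = 2 (H_b0(m0) - max(0, H_b0(m))), which agree iff H_b0(m) >= 0. *)

Set Implicit Arguments.
Unset Strict Implicit.
Unset Printing Implicit Defensive.

Import Order.TTheory GRing.Theory Num.Theory.
Import numFieldNormedType.Exports.
Local Open Scope classical_set_scope.
Local Open Scope ring_scope.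

(** * Calculus of the rate function *)

Section RealAnalysis.
Context {R : realType}.
Implicit Types (p n : nat) (a b c x y z : R).

Lemma mvt (f df : R -> R) a b : a < b ->
  (forall x, a <= x <= b -> {for x, continuous f}) ->
  (forall x, a < x < b -> is_derive x 1 f (df x)) ->
  exists2 c, a < c < b & f b - f a = df c * (b - a).
Proof.
move=> ab cf dfE.
have dfE' x : x \in `]a, b[%R -> is_derive x 1 f (df x).
  by rewrite in_itv /=; exact: dfE.
have cf' : {within `[a, b], continuous f}.
  apply: continuous_in_subspaceT => x.
  by rewrite inE /= in_itv /=; exact: cf.
have [c] := MVT ab dfE' cf'.
by rewrite in_itv; exists c.
Qed.

Lemma deriv_pos_lt (f df : R -> R) a b : a < b -> continuous f ->
  (forall x, a < x < b -> is_derive x 1 f (df x)) ->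
  (forall x, a < x < b -> 0 < df x) -> f a < f b.
Proof.
move=> ab cf dfE pos; have [c cab fE] := mvt ab (fun x _ => cf x) dfE.
by rewrite -subr_gt0 fE mulr_gt0 ?pos // subr_gt0.
Qed.

Lemma deriv_neg_lt (f df : R -> R) a b : a < b -> continuous f ->
  (forall x, a < x < b -> is_derive x 1 f (df x)) ->
  (forall x, a < x < b -> df x < 0) -> f b < f a.
Proof.
move=> ab cf dfE neg; have [c cab fE] := mvt ab (fun x _ => cf x) dfE.
by rewrite -subr_lt0 fE pmulr_llt0 ?neg // subr_gt0.
Qed.

Lemma is_derive_continuous (f : R -> R) x df :
  is_derive x 1 f df -> {for x, continuous f}.
Proof.
by move=> [dfx _]; apply/differentiable_continuous; rewrite -derivable1_diffP.
Qed.

(** With [x = s ^+ 2], the left side is [2 * s * (s * ln s^-1)], and [ln t < t] at [t = s^-1] makes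
    the bracket smaller than 1. *)
Lemma xlnx_norm_lt x : 0 < x < 1 -> `|x * ln x| < 2 * Num.sqrt x.
Proof.
move=> /andP[x0 x1]; set s := Num.sqrt x.
have s0 : 0 < s by rewrite sqrtr_gt0.
have sE : x = s ^+ 2 by rewrite sqr_sqrtr // ltW.
have lnx : ln x < 0 by rewrite ln_lt0 // x0.
rewrite normrM (gtr0_norm x0) (ltr0_norm lnx) {2}sE lnXn // mulr2n.
have : ln s^-1 < s^-1 by rewrite ln_sublinear // invr_gt0.
rewrite lnV // => hs.
have hs' : s * - ln s < 1.
  by rewrite -(divff (lt0r_neq0 s0)) ltr_pM2l.
rewrite sE; nra.
Qed.

(* [ln] vanishes on the negative half-line, so continuity holds everywhere. *)
Lemma continuous_xlnx : continuous (fun x : R => x * ln x).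
Proof.
move=> y; have [y0|y0|->] := ltgtP y 0.
- apply: (near_cst_continuous (0 : R)).
  near=> x; rewrite ln0 ?mulr0 //; apply: ltW.
  by near: x; exact: lt_nbhsl.
- apply: continuousM; first exact: cvg_id.
  exact: continuous_ln.
- rewrite /continuous_at mul0r; apply/cvgrPdist_lt => e e0.
  near=> x; rewrite sub0r normrN.
  have [x0|x0] := leP x 0; first by rewrite ln0 // mulr0 normr0.
  have x1 : x < 1 by near: x; exact: lt_nbhsl.
  apply: (lt_trans (xlnx_norm_lt _)); first by rewrite x0.
  have xe : x < (e / 2) ^+ 2.
    by near: x; apply: lt_nbhsl; rewrite exprn_gt0 ?divr_gt0.
  rewrite mulrC -ltr_pdivlMr // -[ltRHS](@gtr0_norm _ (e / 2)) ?divr_gt0 //.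
  by rewrite -sqrtr_sqr ltr_sqrt // exprn_gt0 ?divr_gt0.
Unshelve. all: by end_near. Qed.

(** The Cramér rate function of a fair spin, so that [H] is energy minus [ent]. Its derivative [ath]
    is the inverse hyperbolic tangent. *)
Definition ent x : R := 2^-1 * ((1 + x) * ln (1 + x) + (1 - x) * ln (1 - x)).
Definition ath x : R := 2^-1 * (ln (1 + x) - ln (1 - x)).

Lemma HE b p x : H b p x = b * x ^+ p - ent x. Proof. by []. Qed.

Lemma continuous_ent : continuous ent.
Proof.
have ca (s : R) : continuous (fun x => (1 + s * x) * ln (1 + s * x)).
  move=> x; apply: (@continuous_comp _ _ _ (fun x => 1 + s * x) (fun x => x * ln x)).
    by apply: cvgD; [exact: cvg_cst|apply: cvgM; [exact: cvg_cst|exact: cvg_id]].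
  exact: continuous_xlnx.
have -> : ent = (fun x => 2^-1 * ((1 + 1 * x) * ln (1 + 1 * x) +
    (1 + (-1) * x) * ln (1 + (-1) * x))).
  by apply/funext => x; rewrite /ent mul1r mulN1r.
move=> x; apply: cvgM; first exact: cvg_cst.
by apply: cvgD; exact: ca.
Qed.

Lemma continuous_H b p : continuous (H b p).
Proof.
move=> x; apply: cvgB; last exact: continuous_ent.
by apply: cvgM; [exact: cvg_cst|exact: exprn_continuous].
Qed.

Lemma is_derive_ln1D x : -1 < x -> is_derive x 1 (fun x => ln (1 + x)) (1 + x)^-1.
Proof.
move=> x1; have h : 0 < 1 + x by lra.
have d : is_derive x 1 (fun x : R => 1 + x) 1.
  have -> : (fun x : R => 1 + x) = cst 1 + id by [].
  by apply: is_derive_eq; rewrite add0r.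
by have := @is_derive1_comp R (@ln R) (fun x => 1 + x) x _ _ (is_derive1_ln h) d; rewrite mulr1.
Qed.

Lemma is_derive_ln1B x : x < 1 -> is_derive x 1 (fun x => ln (1 - x)) (- (1 - x)^-1).
Proof.
move=> x1; have h : 0 < 1 - x by lra.
have d : is_derive x 1 (fun x : R => 1 - x) (-1).
  have -> : (fun x : R => 1 - x) = cst 1 - id by [].
  by apply: is_derive_eq; rewrite sub0r.
by have := @is_derive1_comp R (@ln R) (fun x => 1 - x) x _ _ (is_derive1_ln h) d; rewrite mulrN1.
Qed.

Lemma is_derive_ath x : -1 < x < 1 -> is_derive x 1 ath (1 - x ^+ 2)^-1.
Proof.
move=> /andP[x1 x2]; have := is_derive_ln1D x1; have := is_derive_ln1B x2 => d1 d2.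
have -> : ath = 2^-1 *: ((fun x => ln (1 + x)) - (fun x => ln (1 - x))) by [].
apply: is_derive_eq; rewrite /GRing.scale /=; field.
by apply/andP; split; nra.
Qed.

Lemma is_derive_ent x : -1 < x < 1 -> is_derive x 1 ent (ath x).
Proof.
move=> /andP[x1 x2]; have := is_derive_ln1D x1; have := is_derive_ln1B x2 => d1 d2.
have -> : ent = 2^-1 *: ((cst 1 + id) * (fun x => ln (1 + x)) + (cst 1 - id) * (fun x => ln (1 - x))).
  by [].
apply: is_derive_eq; rewrite /GRing.scale /= /ath.
have -> : (cst 1 + id) x = 1 + x by [].
have -> : (cst 1 - id) x = 1 - x by [].
by field; apply/andP; split; lra.
Qed.

Lemma is_derive_expn n x : is_derive x 1 (fun x : R => x ^+ n) (n%:R * x ^+ n.-1).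
Proof.
have -> : (fun x : R => x ^+ n) = (id ^+ n) by rewrite fctE.
by have := is_deriveX n (is_derive_id x (1 : R)); rewrite /GRing.scale /= mulr1.
Qed.

Definition dH p b x : R := b * p%:R * x ^+ p.-1 - ath x.

Lemma is_derive_H b p x : -1 < x < 1 -> is_derive x 1 (H b p) (dH p b x).
Proof.
move=> hx; have d1 := is_derive_expn p x; have d2 := is_derive_ent hx.
have -> : H b p = (b *: (fun x => x ^+ p)) - ent by [].
by apply: is_derive_eq; rewrite /dH /GRing.scale /= mulrA.
Qed.

Lemma is_derive_dH b p x : -1 < x < 1 -> is_derive x 1 (dH p b)
  (b * p%:R * (p.-1%:R * x ^+ p.-2) - (1 - x ^+ 2)^-1).
Proof.
move=> hx; have d1 := is_derive_expn p.-1 x; have d2 := is_derive_ath hx.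
have -> : dH p b = ((b * p%:R) *: (fun x => x ^+ p.-1)) - ath by [].
by apply: is_derive_eq; rewrite /GRing.scale /=.
Qed.

Lemma ath0 : ath 0 = 0.
Proof. by rewrite /ath addr0 subr0 ln1 subrr mulr0. Qed.

Lemma dH0 b p : (3 <= p)%N -> dH p b 0 = 0.
Proof. by case: p => [|[|p]] // _; rewrite /dH ath0 expr0n /= mulr0 subr0. Qed.

(** The derivative [t ^+ k * (k.+1 - k.+3 * t ^+ 2)] changes sign only once on the positive axis,
    from plus to minus. A valley at [t2] would give a nonpositive derivative followed by a
    nonnegative one. *)
Lemma bump_quasiconcave k (t1 t2 t3 : R) : 0 < t1 -> t1 < t2 -> t2 < t3 ->
  let w (t : R) := t ^+ k.+1 * (1 - t ^+ 2) in
  w t2 <= w t1 -> w t2 <= w t3 -> False.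
Proof.
move=> t10 t12 t23 w w1 w3.
pose dw (t : R) := t ^+ k * (k.+1%:R - k.+3%:R * t ^+ 2).
have dwE (t : R) : is_derive t 1 w (dw t).
  have d1 := is_derive_expn k.+1 t; have d2 := is_derive_expn k.+3 t.
  have -> : w = (fun x => x ^+ k.+1) - (fun x => x ^+ k.+3).
    apply/funext => x; transitivity (x ^+ k.+1 - x ^+ k.+3); last by [].
    by rewrite /w !exprS; ring.
  apply: is_derive_eq; rewrite /dw /= !exprS; ring.
have cw (t : R) : {for t, continuous w} by exact: is_derive_continuous (dwE t).
have [s1 /andP[s11 s12] E1] := mvt t12 (fun x _ => cw x) (fun x _ => dwE x).
have [s2 /andP[s21 s22] E2] := mvt t23 (fun x _ => cw x) (fun x _ => dwE x).
have s1p : 0 < s1 by lra.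
have s2p : 0 < s2 by lra.
have h1 : dw s1 <= 0 by rewrite -(@pmulr_lle0 _ (t2 - t1)) ?subr_gt0 // -E1 subr_le0.
have h2 : 0 <= dw s2 by rewrite -(@pmulr_lge0 _ (t3 - t2)) ?subr_gt0 // -E2 subr_ge0.
move: h1 h2; rewrite /dw pmulr_rle0 ?exprn_gt0 // pmulr_rge0 ?exprn_gt0 //.
have : k.+3%:R * s1 ^+ 2 < k.+3%:R * s2 ^+ 2.
  by rewrite ltr_pM2l ?ltr0n // ltr_pXn2r ?nnegrE //; lra.
by lra.
Qed.

(** All later monotonicity facts come from this exclusion of the sign pattern plus, minus, plus.
    Since [dH] vanishes at 0, the pattern would make it rise, fall and rise again; its derivative
    has the sign of [C * w t - 1] with [w] a single bump, so [w] would have a valley. *)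
Lemma dH_shape p c x y z : (3 <= p)%N -> 0 < c -> 0 < x -> x < y -> y < z ->
  z < 1 -> 0 <= dH p c x -> dH p c y <= 0 -> 0 <= dH p c z -> False.
Proof.
move=> hp c0 x0 xy yz z1 hx hy hz.
case: p hp hx hy hz => [|[|[|k]]] // hp hx hy hz.
pose C := c * k.+3%:R * k.+2%:R.
have C0 : 0 < C by rewrite !mulr_gt0.
pose w (t : R) := t ^+ k.+1 * (1 - t ^+ 2).
have dE (t : R) : 0 <= t < 1 -> is_derive t 1 (dH k.+3 c) ((C * w t - 1) / (1 - t ^+ 2)).
  move=> ht; have ht' : -1 < t < 1 by lra.
  have d := is_derive_dH c k.+3 ht'.
  apply: is_derive_eq; rewrite /C /w /=; field; nra.
have slope u v : 0 <= u -> u < v -> v < 1 -> exists t, [/\ u < t, t < v &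
    dH k.+3 c v - dH k.+3 c u = (C * w t - 1) / (1 - t ^+ 2) * (v - u)].
  move=> u0 uv v1.
  have [||t /andP[? ?] E] := mvt uv (f := dH k.+3 c)
    (df := fun t => (C * w t - 1) / (1 - t ^+ 2)).
  - by move=> t ht; apply: is_derive_continuous (dE _ _); lra.
  - by move=> t ht; apply: dE; lra.
  - by exists t.
have slope_ge0 t u v : t < 1 -> 0 < t -> u < v ->
    (0 <= (C * w t - 1) / (1 - t ^+ 2) * (v - u)) = (1 <= C * w t).
  by move=> ? ? ?; rewrite pmulr_lge0 ?subr_gt0 // pmulr_lge0 ?invr_gt0 ?subr_ge0 //; nra.
have slope_le0 t u v : t < 1 -> 0 < t -> u < v ->
    ((C * w t - 1) / (1 - t ^+ 2) * (v - u) <= 0) = (C * w t <= 1).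
  by move=> ? ? ?; rewrite pmulr_lle0 ?subr_gt0 // pmulr_lle0 ?invr_gt0 ?subr_le0 //; nra.
have [|||t1 [t1l t1r E1]] := slope 0 x => //; first by lra.
have [|||t2 [t2l t2r E2]] := slope x y => //; [by lra..|].
have [|||t3 [t3l t3r E3]] := slope y z => //; [by lra..|].
have h1 : 1 <= C * w t1.
  by rewrite -(slope_ge0 t1 0 x) -?E1 ?dH0 ?subr0 //; lra.
have h2 : C * w t2 <= 1.
  by rewrite -(slope_le0 t2 x y) -?E2 //; lra.
have h3 : 1 <= C * w t3.
  by rewrite -(slope_ge0 t3 y z) -?E3 //; lra.
apply: (@bump_quasiconcave k t1 t2 t3); rewrite -/(w t1) -/(w t2) -/(w t3); [lra..| |].
  by rewrite -(ler_pM2l C0); lra.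
by rewrite -(ler_pM2l C0); lra.
Qed.

End RealAnalysis.

(** * Shape of [H] and of the pseudolikelihood function on the unit interval *)

Section Shape.
Context {R : realType}.
Implicit Types (p n : nat) (a b c m x y z : R).

(** For positive [x], the parameter [c] that makes [x] a stationary point of [H c p]. Comparing
    [mpl_fun p x] with a level [c] is thus reading the sign of [dH p c x], and [dH_shape] can be
    applied at any level. *)
Definition mpl_fun p x : R := ath x / (p%:R * x ^+ p.-1).

Lemma dH_mpl_fun p c x : (0 < p)%N -> 0 < x ->
  dH p c x = p%:R * x ^+ p.-1 * (c - mpl_fun p x).
Proof.
move=> p0 x0; rewrite /dH /mpl_fun; field.
by rewrite lt0r_neq0 ?exprn_gt0 // pnatr_eq0 -lt0n p0.
Qed.

Lemma dH_ge0 p c x : (0 < p)%N -> 0 < x -> (0 <= dH p c x) = (mpl_fun p x <= c).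
Proof.
move=> p0 x0; rewrite dH_mpl_fun // pmulr_rge0 ?subr_ge0 //.
by rewrite mulr_gt0 ?exprn_gt0 ?ltr0n.
Qed.

Lemma dH_le0 p c x : (0 < p)%N -> 0 < x -> (dH p c x <= 0) = (c <= mpl_fun p x).
Proof.
move=> p0 x0; rewrite dH_mpl_fun // pmulr_rle0 ?subr_le0 //.
by rewrite mulr_gt0 ?exprn_gt0 ?ltr0n.
Qed.

Lemma H_at0 b p : (0 < p)%N -> H b p 0 = 0.
Proof. by case: p => // p _; rewrite /H expr0n /= addr0 subr0 ln1 !mulr0 addr0 mulr0 subr0. Qed.

(** Maximality is recorded on [[0, 1]] only: [H_le_abs] extends it to [[-1, 1]], and uniqueness is
    recovered in [pos_max_lt]. *)
Definition pos_max p b m := [/\ (3 <= p)%N, 0 < b, 0 < m < 1, 0 < H b p m &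
  forall x, 0 <= x <= 1 -> H b p x <= H b p m].

Lemma dH_max p b m : pos_max p b m -> dH p b m = 0.
Proof.
move=> [hp b0 /andP[m0 m1] Hm mx].
have d : is_derive m 1 (H b p) (dH p b m) by apply: is_derive_H; lra.
have d0 : is_derive m 1 (H b p) 0.
  apply: (@derive1_at_max _ _ 0 1) => // [t||t]; rewrite in_itv /= ?m0 ?m1 // => ht.
  - by have [] : is_derive t 1 (H b p) (dH p b t) by apply: is_derive_H; lra.
  - by apply: mx; lra.
by rewrite -[LHS](@derive_val _ _ _ _ _ _ _ d) (@derive_val _ _ _ _ _ _ _ d0).
Qed.

(** If [dH] were nonnegative at [y], then, as it vanishes at [m], [dH_shape] would keep it positive
    in between, and [H] would exceed its maximum at [y]. *)
Lemma dH_neg_right p b m y : pos_max p b m -> m < y -> y < 1 -> dH p b y < 0.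
Proof.
move=> hm my y1; have hdm := dH_max hm; move: hm => [hp b0 /andP[m0 m1] Hm mx].
rewrite ltNge; apply/negP => hy.
have : H b p m < H b p y.
  apply: (@deriv_pos_lt _ _ (dH p b)) => //; first exact: continuous_H.
    by move=> x hx; apply: is_derive_H; lra.
  move=> x /andP[x1 x2]; rewrite ltNge; apply/negP => hx.
  by apply: (@dH_shape _ p b m x y) => //; rewrite hdm.
by apply/negP; rewrite -leNgt mx //; lra.
Qed.

Lemma H_decr_right p b m u v : pos_max p b m -> m <= u -> u < v -> v <= 1 ->
  H b p v < H b p u.
Proof.
move=> hm mu uv v1; have [_ _ /andP[m0 m1] _ _] := hm.
apply: (@deriv_neg_lt _ _ (dH p b)) => //; first exact: continuous_H.
  by move=> x hx; apply: is_derive_H; lra.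
by move=> x /andP[x1 x2]; apply: (dH_neg_right hm); lra.
Qed.

Lemma H_decr_right_le p b m u v : pos_max p b m -> m <= u -> u <= v -> v <= 1 ->
  H b p v <= H b p u.
Proof.
move=> hm mu; rewrite le_eqVlt => /orP[/eqP->//|uv v1].
exact/ltW/(H_decr_right hm).
Qed.

(** To the right of [m] this is strict decrease. A second maximizer [y < m] would satisfy [pos_max]
    itself, so [H] would strictly decrease from [y] to [m]. *)
Lemma pos_max_lt p b m y : pos_max p b m -> 0 <= y <= 1 -> y != m ->
  H b p y < H b p m.
Proof.
move=> hm /andP[y0 y1] ym; have [hp b0 /andP[m0 m1] Hm mx] := hm.
have [my|ym'|E] := ltgtP m y; last by rewrite E eqxx in ym.
  by rewrite (H_decr_right hm).
rewrite lt_neqAle mx ?y0 // andbT; apply/eqP => E.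
have hy : pos_max p b y.
  split => //; rewrite ?E //.
  rewrite (le_lt_trans _ (lt_trans ym' m1)) // andbT lt_neqAle y0 andbT.
  by apply/eqP => y0E; move: Hm; rewrite -E -y0E H_at0 ?ltxx //; case: (p) hp.
by have := H_decr_right hy (lexx y) ym' (ltW m1); rewrite E ltxx.
Qed.

Lemma mpl_fun_max p b m : pos_max p b m -> mpl_fun p m = b.
Proof.
move=> hm; have := dH_max hm; have [hp b0 /andP[m0 m1] Hm mx] := hm.
have p0 : (0 < p)%N by case: (p) hp.
by move=> E; apply/eqP; rewrite eq_le -dH_ge0 // -dH_le0 // E lexx.
Qed.

(** Beyond [m] the function exceeds its value [b] at [m]. If it did not increase from [u] to [w],
    then at the level [mpl_fun p u] the points [m], [u], [w] would show the pattern excluded by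
    [dH_shape]. *)
Lemma mpl_fun_incr p b m u w : pos_max p b m -> m <= u -> u < w -> w < 1 ->
  mpl_fun p u < mpl_fun p w.
Proof.
move=> hm; have [hp b0 /andP[m0 m1] Hm mx] := hm.
have p0 : (0 < p)%N by case: (p) hp.
have gm := mpl_fun_max hm.
have right y : m < y -> y < 1 -> b < mpl_fun p y.
  by move=> my y1; rewrite ltNge -dH_ge0 // -?ltNge ?(dH_neg_right hm) //; lra.
rewrite le_eqVlt => /orP[/eqP<-|mu] uw w1; first by rewrite gm right.
have bu : b < mpl_fun p u by apply: right => //; lra.
rewrite ltNge; apply/negP => wu.
apply: (@dH_shape _ p (mpl_fun p u) m u w) => //; rewrite ?dH_ge0 ?dH_le0 ?gm //; lra.
Qed.

Lemma mpl_fun_mono p b m u w : pos_max p b m -> m <= u < 1 -> m <= w < 1 ->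
  (mpl_fun p u < mpl_fun p w) = (u < w).
Proof.
move=> hm /andP[mu u1] /andP[mw w1]; have [uw|wu] := ltP u w.
  by rewrite (mpl_fun_incr hm).
apply/negbTE; rewrite -leNgt; move: wu; rewrite le_eqVlt => /orP[/eqP->//|wu].
by rewrite ltW // (mpl_fun_incr hm).
Qed.

(* Strict quasi-convexity of [mpl_fun] forces [mpl_fun > b], that is
   [H' < 0], on the whole interval from 0 to [y]. *)
Lemma H_neg_left p b m y M : pos_max p b m -> 0 < y -> y < M -> m <= M -> M < 1 ->
  mpl_fun p M < mpl_fun p y -> H b p y < 0.
Proof.
move=> hm y0 yM mM M1 gMy; have [hp b0 /andP[m0 m1] Hm mx] := hm.
have p0 : (0 < p)%N by case: (p) hp.
have bM : b <= mpl_fun p M.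
  rewrite -(mpl_fun_max hm); move: mM; rewrite le_eqVlt => /orP[/eqP->//|mM].
  by rewrite ltW // (mpl_fun_incr hm).
rewrite -(H_at0 b p0).
apply: (@deriv_neg_lt _ _ (dH p b)) => //; first exact: continuous_H.
  by move=> x hx; apply: is_derive_H; lra.
move=> x /andP[x0 xy]; rewrite ltNge; apply/negP; rewrite dH_ge0 // => xb.
apply: (@dH_shape _ p (mpl_fun p y) x y M) => //; rewrite ?dH_ge0 ?dH_le0 //; lra.
Qed.

(** At [m0] the derivative for [b] is a positive multiple of [b - b0], whereas it would be negative
    if [m0] lay to the right of [m1]. *)
Lemma pos_max_arg_lt p b0 b m0 m1 : pos_max p b0 m0 -> pos_max p b m1 -> b0 < b -> m0 < m1.
Proof.
move=> h0 h1 b0b; rewrite ltNge; apply/negP => m10.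
have [hp b00 /andP[m00 m01] _ _] := h0.
have [_ _ /andP[m11 m12] _ _] := h1.
have p0 : (0 < p)%N by case: (p) hp.
have := dH_max h0; have E1 := dH_max h1.
move: m10; rewrite le_eqVlt => /orP[/eqP E|m10] E0.
  have := mpl_fun_max h0; rewrite -E (mpl_fun_max h1) => bE; move: b0b; rewrite bE ltxx //.
have : 0 < dH p b m0.
  by rewrite dH_mpl_fun // (mpl_fun_max h0) mulr_gt0 ?subr_gt0 // mulr_gt0 ?exprn_gt0 // ltr0n.
by apply/negP; rewrite -leNgt ltW // (dH_neg_right h1).
Qed.

Lemma H_at1 b p : H b p 1 = b - ln 2.
Proof. by rewrite /H expr1n mulr1 subrr mul0r addr0 -[1 + 1]/(2:R) mulrA mulVf ?mul1r // pnatr_eq0. Qed.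

Lemma ath_incr x y : -1 < x -> x <= y -> y < 1 -> y - x <= ath y - ath x.
Proof.
move=> x1; rewrite le_eqVlt => /orP[/eqP<-|xy] y1; first by rewrite !subrr.
have [||c /andP[xc cy] ->] := mvt xy (f := @ath R) (df := fun t => (1 - t ^+ 2)^-1).
- by move=> t ht; apply: (@is_derive_continuous _ _ _ (1 - t ^+ 2)^-1);
    apply: is_derive_ath; lra.
- by move=> t ht; apply: is_derive_ath; lra.
by rewrite ler_peMl ?invf_ge1; nra.
Qed.

(** Strong convexity with modulus 1, because [ath] has slope at least 1: the difference [k] has
    derivative of the sign of [t - y], hence its minimum at [y]. The quadratic gain drives the
    concentration in [bern_near]. *)
Lemma ent_tangent y x : -1 < y < 1 -> -1 <= x <= 1 ->
  ent y + ath y * (x - y) + (x - y) ^+ 2 / 2 <= ent x.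
Proof.
move=> /andP[y0 y1] /andP[x0 x1].
pose k t := ent t - ath y * t - (t - y) ^+ 2 / 2.
have ck : continuous k.
  move=> t; apply: cvgB; last first.
    apply: cvgM; last exact: cvg_cst.
    by apply: (@continuous_comp _ _ _ (fun t => t - y) (fun t => t ^+ 2));
      [apply: cvgB; [exact: cvg_id|exact: cvg_cst]|exact: exprn_continuous].
  apply: cvgB; first exact: continuous_ent.
  by apply: cvgM; [exact: cvg_cst|exact: cvg_id].
have dk (t : R) : -1 < t < 1 -> is_derive t 1 k (ath t - ath y - (t - y)).
  move=> ht; have d1 := is_derive_ent ht.
  have -> : k = ent - (ath y *: id) - (2^-1 *: ((id - cst y) ^+ 2)).
    apply/funext => u; transitivity (ent u - ath y * u - 2^-1 * (u - y) ^+ 2); last by [].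
    by rewrite /k [_ / 2]mulrC.
  apply: is_derive_eq; rewrite /GRing.scale /=.
  have -> : (id - cst y) t = t - y by [].
  by rewrite subr0 !mulr1 expr1; field.
suff : k y <= k x.
  rewrite /k subrr expr0n /= mul0r subr0; nra.
have [xy|yx|->] := ltgtP x y; last by rewrite lexx.
- have [c /andP[xc cy] E] := mvt xy (fun t _ => ck t) (fun t ht => dk t ltac:(lra)).
  rewrite -subr_le0 E pmulr_lle0 ?subr_gt0 //.
  have := @ath_incr c y; lra.
- have [c /andP[xc cy] E] := mvt yx (fun t _ => ck t) (fun t ht => dk t ltac:(lra)).
  rewrite -subr_ge0 E pmulr_lge0 ?subr_gt0 //.
  have := @ath_incr y c; lra.
Qed.

Lemma ent0 : ent (0 : R) = 0.
Proof. by rewrite /ent addr0 subr0 ln1 !mulr0 addr0 mulr0. Qed.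

Lemma ent_ge0 x : -1 <= x <= 1 -> 0 <= ent x.
Proof.
move=> hx; have h0 : -1 < (0 : R) < 1 by lra.
have := ent_tangent h0 hx; rewrite ent0 ath0; nra.
Qed.

Lemma entN x : ent (- x) = ent x.
Proof. by rewrite /ent opprK addrC. Qed.

Lemma H_le_abs b p x : 0 <= b -> H b p x <= H b p `|x|.
Proof.
move=> b0; rewrite !HE; have -> : ent `|x| = ent x.
  by have [h|h] := leP 0 x; [rewrite ger0_norm|rewrite ltr0_norm // entN].
by rewrite lerB // ler_wpM2l // -normrX ler_norm.
Qed.

Lemma H_le b p x : 0 <= b -> -1 <= x <= 1 -> H b p x <= b.
Proof.
move=> b0 hx; rewrite HE lerBlDr ler_wpDr ?ent_ge0 // -[leRHS]mulr1 ler_wpM2l //.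
by rewrite (le_trans (ler_norm _)) // normrX exprn_ile1 // ler_norml.
Qed.

Lemma itv11 x : `[-1, 1]%classic x = (-1 <= x <= 1) :> Prop.
Proof. by rewrite /= in_itv. Qed.

(** The set defining [beta_star] contains 0 and is bounded by [ln 2], as its members satisfy
    [c - ln 2 = H c p 1 <= 0]; so its [sup] is genuine. A larger [b] lies outside the set, and its
    supremum of [H], being at least [H b p 0 = 0], is positive. *)
Lemma beta_star_lt p b : (0 < p)%N -> beta_star p < b ->
  0 < b /\ exists2 x, -1 <= x <= 1 & 0 < H b p x.
Proof.
move=> p0; rewrite /beta_star; set S := (X in sup X) => Sb.
have imub c : 0 <= c -> has_ubound [set H c p x | x in `[-1, 1]%classic].
  by move=> c0; exists c => _ /= [x hx <-]; apply: H_le; rewrite -?itv11.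
have im0 c : [set H c p x | x in `[-1, 1]%classic] 0.
  by exists 0; [rewrite itv11; lra|rewrite H_at0].
have Sbd : has_ubound S.
  exists (ln 2) => c [c0 sc].
  have : H c p 1 <= 0.
    by rewrite -sc; apply: ub_le_sup (imub c c0) _ _; exists 1 => //; rewrite itv11; lra.
  by rewrite H_at1 subr_le0.
have S0 : S 0.
  split => //; apply/eqP; rewrite eq_le; apply/andP; split.
    apply: ge_sup; first by exists 0; exact: im0.
    by move=> _ [x hx <-]; apply: H_le; rewrite -?itv11.
  exact: ub_le_sup (imub 0 (lexx _)) _ (im0 0).
have b0 : 0 < b by apply: le_lt_trans Sb; exact: ub_le_sup.
split => //.
have sb0 : 0 < sup [set H b p x | x in `[-1, 1]%classic].
  rewrite lt_neqAle (ub_le_sup (imub b (ltW b0)) (im0 b)) andbT eq_sym.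
  apply/eqP => sE; have : b <= sup S by apply: ub_le_sup => //; split => //; exact: ltW.
  by rewrite leNgt Sb.
have [_ [x hx <-] Hx] := sup_gt (ex_intro _ 0 (im0 b)) sb0.
by exists x => //; rewrite -itv11.
Qed.

Lemma pos_max_exists p b : (3 <= p)%N -> beta_star p < b -> exists m, pos_max p b m.
Proof.
move=> hp; have p0 : (0 < p)%N by case: (p) hp.
move=> /(beta_star_lt p0)[b0 [x hx Hx]].
have cH : {within `[0, 1], continuous (H b p)}.
  exact/continuous_subspaceT/continuous_H.
have [m] := EVT_max ler01 cH; rewrite in_itv /= => /andP[m0 m1] mx.
have Hm : 0 < H b p m.
  apply: (lt_le_trans Hx); apply: (le_trans (H_le_abs p x (ltW b0))).
  by apply: mx; rewrite in_itv /= normr_ge0 ler_norml.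
exists m; split => //; apply/andP; split.
  by rewrite lt_neqAle m0 andbT; apply/eqP => E; move: Hm; rewrite -E H_at0 ?ltxx.
rewrite lt_neqAle m1 andbT; apply/eqP => E.
(* The point past which [ath] exceeds [b * p], an upper bound for the derivative of the energy. So
   [H] decreases on [[y, 1]] and 1 is not a maximizer. *)
pose y := 1 - expR (- 2 * (b * p%:R)) : R.
have e0 : 0 < expR (- 2 * (b * p%:R)) by exact: expR_gt0.
have bp0 : 0 < b * p%:R by rewrite mulr_gt0 // ltr0n.
have e1 : expR (- 2 * (b * p%:R)) < 1 by rewrite expR_lt1; lra.
have y1 : y < 1 by rewrite /y; lra.
have : H b p 1 < H b p y.
  apply: (@deriv_neg_lt _ _ (dH p b)) => //; first exact: continuous_H.
    by move=> t; rewrite /y => ht; apply: is_derive_H; lra.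
  move=> t; rewrite /y => /andP[t1 t2].
  have ht : b * p%:R < ath t.
    have : ln (1 - t) < - 2 * (b * p%:R).
      by rewrite -[ltRHS]expRK ltr_ln ?posrE //; lra.
    have : 0 <= ln (1 + t) by apply: ln_ge0; lra.
    rewrite /ath; lra.
  have tp : t ^+ p.-1 <= 1 by apply: exprn_ile1; lra.
  by rewrite /dH subr_lt0 (le_lt_trans _ ht) // ler_piMr // ltW.
by apply/negP; rewrite -leNgt -E; apply: mx; rewrite in_itv /= /y; lra.
Qed.

Lemma m_star_pos_max p b : (3 <= p)%N -> beta_star p < b -> pos_max p b (m_star b p).
Proof.
move=> hp hb; have [m hm] := pos_max_exists hp hb.
have [_ b0 /andP[m0 m1] Hm mx] := hm.
have [hs mxs] : [set m | 0 < m < 1 /\ forall x, -1 <= x <= 1 -> H b p x <= H b p m]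
    (m_star b p).
  apply: xgetPex; exists m; split; first by rewrite m0.
  move=> x hx; apply: (le_trans (H_le_abs p x (ltW b0))).
  by apply: mx; rewrite normr_ge0 ler_norml.
split => //; first by apply: (lt_le_trans Hm); apply: mxs; lra.
by move=> x hx; apply: mxs; lra.
Qed.

(** Since [ath y >= y], the function is at least [y ^ (2 - p) / p], which is unbounded near 0 for
    [p >= 3]. *)
Lemma mpl_fun_near0 p (K : R) : (3 <= p)%N -> 0 < K ->
  exists2 d, 0 < d < 1 & forall y, 0 < y < d -> K < mpl_fun p y.
Proof.
case: p => [|[|[|k]]] // _ K0; set P : R := k.+3%:R.
have P0 : 0 < P by rewrite ltr0n.
have PK : 0 < P * K by rewrite mulr_gt0.
exists ((1 + P * K)^-1).
  by rewrite invr_gt0 invf_lt1; lra.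
move=> y /andP[y0 yd].
have yPK : y * (1 + P * K) < 1 by rewrite -ltr_pdivlMr ?div1r //; lra.
have y1 : y < 1 by nra.
have ay : y <= ath y by have := @ath_incr 0 y; rewrite ath0 !subr0; apply; lra.
rewrite /mpl_fun -/P ltr_pdivlMr; last by rewrite mulr_gt0 ?exprn_gt0.
rewrite [_.-1]/=.
apply: (lt_le_trans _ ay).
have yk : y ^+ k <= 1 by apply: exprn_ile1; lra.
have yk0 : 0 <= y ^+ k by apply: exprn_ge0; lra.
have -> : K * (P * y ^+ k.+2) = y * (y * (P * K)) * y ^+ k by rewrite !exprS; ring.
have : y * (y * (P * K)) < y by nra.
have : 0 <= y * (y * (P * K)) by rewrite !mulr_ge0 //; lra.
nra.
Qed.

End Shape.

(** * Large deviations of the magnetization *)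

Section LargeDeviations.
Context {R : realType}.
Implicit Types (p n : nat) (b c m v y z : R).

(** The square of [1 + n c / 2 <= exp (n c / 2)] gives a quadratic lower bound. This absorbs every
    polynomial factor into the exponent. *)
Lemma poly_le_exp (C c : R) : 0 < C -> 0 < c ->
  exists N, forall n, (N <= n)%N -> C * n.+1%:R <= expR (n%:R * c).
Proof.
move=> C0 c0; set B := 8 * C / c ^+ 2.
have B0 : 0 <= B by rewrite divr_ge0 ?mulr_ge0 ?exprn_ge0 //; exact: ltW.
exists (Num.bound B).+1 => n hn.
have n1 : 1 <= n%:R :> R by rewrite ler1n (leq_ltn_trans _ hn).
have Bn : B <= n%:R.
  by rewrite (le_trans (ltW (archi_boundP B0))) // ler_nat ltnW.
have h : 1 + n%:R * (c / 2) <= expR (n%:R * (c / 2)) by exact: expR_ge1Dx.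
have -> : n%:R * c = n%:R * (c / 2) + n%:R * (c / 2) by field.
have nc0 : 0 <= n%:R * (c / 2) by rewrite mulr_ge0 // divr_ge0 // ltW.
have h2 : (n%:R * (c / 2)) ^+ 2 <= expR (n%:R * (c / 2) + n%:R * (c / 2)).
  by rewrite expRD expr2 ler_pM //; lra.
apply: le_trans h2.
have hB : 8 * C <= n%:R * c ^+ 2 by rewrite -ler_pdivrMr // exprn_gt0.
have : n%:R * (8 * C) <= n%:R * (n%:R * c ^+ 2) by rewrite ler_wpM2l.
rewrite -natr1; nra.
Qed.

Lemma xbar_sum n (x : config n) : (0 < n)%N ->
  \sum_(i < n) spin x i = n%:R * xbar x :> R.
Proof. by move=> n0; rewrite /xbar mulrC divfK // pnatr_eq0 -lt0n. Qed.

Lemma spin_itv n (x : config n) i : -1 <= (spin x i : R) <= 1.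
Proof. by rewrite /spin; case: (x i); lra. Qed.

Lemma xbar_itv n (x : config n) : -1 <= (xbar x : R) <= 1.
Proof.
case: n x => [|n] x; first by rewrite /xbar big_ord0 mul0r; lra.
rewrite /xbar ler_pdivlMr ?ltr0n // ler_pdivrMr ?ltr0n // mul1r mulN1r.
have cE (c : R) : c *+ n.+1 = \sum_(i < n.+1) c by rewrite sumr_const card_ord.
by rewrite -mulNrn !cE; apply/andP; split; apply: ler_sum => i _;
  case/andP: (spin_itv x i).
Qed.

Lemma cw_hamiltonianE p n (x : config n) : (0 < p)%N ->
  cw_hamiltonian p x = n%:R * xbar x ^+ p :> R.
Proof.
case: p => // p _; rewrite /cw_hamiltonian subn1 /=.
rewrite -(bigA_distr_bigA (fun (_ : 'I_p.+1) j => spin x j)) /=.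
rewrite prodr_const card_ord; case: n x => [|n] x.
  by rewrite big_ord0 expr0n /= mulr0 mul0r.
by rewrite xbar_sum // exprMn [n.+1%:R ^+ p.+1]exprSr -!mulrA mulKf // expf_neq0 // pnatr_eq0.
Qed.

(** Keeping the uniform factor [2 ^- n] makes the total mass equal to [Zn]. *)
Definition weight b p n (x : config n) : R :=
  2 ^- n * expR (n%:R * (b * xbar x ^+ p)).

Definition mass b p n (A : pred (config n)) : R := \sum_(x | A x) weight b p x.

Lemma weight_gt0 b p n (x : config n) : 0 < weight b p x.
Proof. by rewrite mulr_gt0 ?expR_gt0 // invr_gt0 exprn_gt0. Qed.

Lemma Zn_mass b p n : (0 < p)%N -> Zn b p n = mass b p (@predT (config n)).
Proof.
move=> p0; rewrite /Zn big_distrr /=; apply: eq_bigr => x _.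
by rewrite cw_hamiltonianE // mulrCA.
Qed.

Lemma mass_ge0 b p n (A : pred (config n)) : 0 <= mass b p A.
Proof. by apply: sumr_ge0 => x _; rewrite ltW ?weight_gt0. Qed.

Lemma mass_gt0 b p n : 0 < mass b p (@predT (config n)).
Proof.
rewrite /mass (bigD1 [ffun _ => true]) //= ltr_pwDl ?weight_gt0 //.
exact: mass_ge0.
Qed.

Lemma cw_pmfE b p n (x : config n) : (0 < p)%N ->
  cw_pmf b p x = weight b p x / Zn b p n.
Proof.
move=> p0; rewrite /cw_pmf cw_hamiltonianE // /weight [b * (_ * _)]mulrCA.
by rewrite [_^-1 * expR _]mulrC -mulrA -invfM.
Qed.

Lemma cw_probE b p n (A : pred (config n)) : (0 < p)%N ->
  cw_prob b p A = mass b p A / Zn b p n.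
Proof.
by move=> p0; rewrite /cw_prob big_distrl /=; apply: eq_bigr => x _; exact: cw_pmfE.
Qed.

Lemma Zn_gt0 b p n : (0 < p)%N -> 0 < Zn b p n.
Proof. by move=> p0; rewrite Zn_mass ?mass_gt0. Qed.

Lemma cw_prob_ge0 b p n (A : pred (config n)) : (0 < p)%N -> 0 <= cw_prob b p A.
Proof. by move=> p0; rewrite cw_probE // divr_ge0 ?mass_ge0 ?ltW ?Zn_gt0. Qed.

Lemma cw_probT b p n : (0 < p)%N -> cw_prob b p (@predT (config n)) = 1.
Proof. by move=> p0; rewrite cw_probE // Zn_mass // divff // lt0r_neq0 ?mass_gt0. Qed.

Lemma mass_le b p n (A B : pred (config n)) : (forall x, A x -> B x) ->
  mass b p A <= mass b p B.
Proof.
move=> AB; rewrite /mass (bigID A B) /=.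
rewrite (eq_bigl A) => [|x]; last by apply/andP/idP => [[]|Ax] //; split=> //; exact: AB.
by rewrite lerDl; apply: sumr_ge0 => x _; rewrite ltW ?weight_gt0.
Qed.

Lemma cw_prob_le b p n (A B : pred (config n)) : (0 < p)%N ->
  (forall x, A x -> B x) -> cw_prob b p A <= cw_prob b p B.
Proof.
by move=> p0 AB; rewrite !cw_probE // ler_wpM2r ?invr_ge0 ?(ltW (Zn_gt0 _ _ _)) // mass_le.
Qed.

Lemma cw_probC b p n (A : pred (config n)) : (0 < p)%N ->
  1 - cw_prob b p A = cw_prob b p (predC A).
Proof.
move=> p0; rewrite -(cw_probT b n p0) /cw_prob (bigID A predT) /=.
by rewrite [X in X - _]addrC addrK.
Qed.

Lemma cw_prob_or b p n (A B C : pred (config n)) : (0 < p)%N ->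
  (forall x, A x -> B x || C x) -> cw_prob b p A <= cw_prob b p B + cw_prob b p C.
Proof.
move=> p0 ABC; apply: (le_trans (cw_prob_le b p0 ABC)).
rewrite /cw_prob (bigID B) /=; apply: lerD.
  by rewrite le_eqVlt; apply/orP; left; apply/eqP/eq_bigl => x; rewrite andbC; case: (B x).
apply: (@le_trans _ _ (cw_prob b p (fun x => ~~ B x && C x))).
  by rewrite /cw_prob le_eqVlt; apply/orP; left; apply/eqP/eq_bigl => x /=; rewrite andbC; case: (B x).
by apply: cw_prob_le => // x /andP[].
Qed.

(** The product Bernoulli measure. Its total mass 1 takes the place of estimates on binomial
    coefficients. *)
Definition bern (q : R) n (x : config n) : R := \prod_(i < n) (if x i then q else 1 - q).

Lemma bern_sum (q : R) n : \sum_(x : config n) bern q x = 1.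
Proof.
rewrite -(bigA_distr_bigA (fun _ (s : bool) => if s then q else 1 - q)) /=.
by rewrite big1 // => i _; rewrite big_bool /= subrKC.
Qed.

(** Positivity is asked only of the factors that occur, which admits [q = 0] or [q = 1] when all
    spins agree; the logarithm of the absent factor then has coefficient 0. *)
Lemma bern_exp (q : R) n (x : config n) : (0 < n)%N ->
  (forall i, 0 < (if x i then q else 1 - q)) ->
  bern q x = expR (n%:R * ((1 + xbar x) / 2 * ln q + (1 - xbar x) / 2 * ln (1 - q))).
Proof.
move=> n0 fpos; transitivity (expR (\sum_(i < n)
    ((1 + spin x i) / 2 * ln q + (1 - spin x i) / 2 * ln (1 - q)))).
  rewrite expR_sum; apply: eq_bigr => i _; have := fpos i; rewrite /spin.
  case: (x i) => h.
    by rewrite subrr mul0r mul0r addr0 divff ?pnatr_eq0 // mul1r lnK.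
  by rewrite subrr mul0r mul0r add0r opprK divff ?pnatr_eq0 // mul1r lnK.
congr expR.
rewrite big_split /= -!big_distrl /= !big_split /= sumrN.
rewrite !sumr_const card_ord xbar_sum //.
by rewrite -[1 *+ n]/(n%:R); ring.
Qed.

Lemma bern_xbar n (x : config n) : (0 < n)%N ->
  bern ((1 + xbar x) / 2) x = 2 ^- n * expR (n%:R * ent (xbar x)).
Proof.
move=> n0; set m : R := xbar x.
have nR : 0 < n%:R :> R by rewrite ltr0n.
have mE : n%:R * m = \sum_(i < n) spin x i by rewrite xbar_sum.
have nE : n%:R = \sum_(i < n) (1 : R) by rewrite sumr_const card_ord.
have qE : 1 - (1 + m) / 2 = (1 - m) / 2 by field.
rewrite bern_exp //; last first.
  (* [n (1 + m)] is the sum of the nonnegative terms [1 + spin x j], and a spin equal to 1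
     contributes 2; symmetrically for [n (1 - m)]. *)
  move=> i; rewrite qE; case: ifP => xi; apply: divr_gt0 => //.
    rewrite -(pmulr_rgt0 _ nR) mulrDr mulr1 mE nE -big_split /= (bigD1 i) //= {1}/spin xi.
    rewrite ltr_pwDl ?addr_gt0 //; apply: sumr_ge0 => j _.
    by have := spin_itv x j; lra.
  rewrite -(pmulr_rgt0 _ nR) mulrBr mulr1 mE nE -sumrB /= (bigD1 i) //= {1}/spin xi opprK.
  rewrite ltr_pwDl ?addr_gt0 //; apply: sumr_ge0 => j _.
  by have := spin_itv x j; lra.
rewrite qE; have := xbar_itv x; rewrite -/m => /andP[m1 m2].
have lnh (z : R) : 0 <= z -> z / 2 * ln (z / 2) = z / 2 * (ln z - ln 2).
  rewrite le_eqVlt => /orP[/eqP<-|z0]; first by rewrite !mul0r.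
  by rewrite ln_div // posrE.
rewrite !lnh; [|lra..].
have -> : n%:R * ((1 + m) / 2 * (ln (1 + m) - ln 2) + (1 - m) / 2 * (ln (1 - m) - ln 2)) =
    n%:R * ent m - n%:R * ln 2 by rewrite /ent; field.
by rewrite expRB mulrC; congr (_^-1 * _); rewrite expRM_natl lnK // posrE.
Qed.

(* Every magnetization is one of the [n + 1] values [2k/n - 1], and each of the
   corresponding product measures has total mass 1. *)
Lemma sum_exp_ent_le n : (0 < n)%N ->
  \sum_(x : config n) 2 ^- n * expR (n%:R * ent (xbar x)) <= n.+1%:R :> R.
Proof.
move=> n0; have nR : 0 < n%:R :> R by rewrite ltr0n.
pose q (k : nat) : R := k%:R / n%:R.
have q01 (k : 'I_n.+1) : 0 <= q k <= 1.
  by rewrite divr_ge0 //= ler_pdivrMr // mul1r ler_nat -ltnS.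
have -> : n.+1%:R = \sum_(k < n.+1) \sum_(x : config n) bern (q k) x.
  by under eq_bigr do rewrite bern_sum; rewrite sumr_const card_ord.
rewrite exchange_big /=; apply: ler_sum => x _.
have kP : (\sum_(i < n) x i < n.+1)%N.
  rewrite ltnS -[leqRHS]card_ord -sum1_card; apply: leq_sum => i _; exact: leq_b1.
have qE : (1 + xbar x) / 2 = q (Ordinal kP).
  rewrite /q /= natr_sum /xbar.
  have -> : \sum_(i < n) (x i)%:R = \sum_(i < n) (1 + spin x i) / 2 :> R.
    by apply: eq_bigr => i _; rewrite /spin; case: (x i) => /=; field.
  rewrite -big_distrl /= big_split /= sumr_const card_ord -[1 *+ n]/(n%:R); field.
  by rewrite lt0r_neq0.
rewrite -bern_xbar // qE (bigD1 (Ordinal kP)) //= lerDl.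
apply: sumr_ge0 => k _; apply: prodr_ge0 => i _.
by have /andP[? ?] := q01 k; case: ifP => _; lra.
Qed.

(** The weight factors as [2 ^- n * exp (n ent)] times [exp (n H)]; the second factor is at most
    [exp (n v)] on [A], and the first sums to at most [n + 1]. *)
Lemma mass_upper b p n (A : pred (config n)) v : (0 < n)%N ->
  (forall x, A x -> H b p (xbar x) <= v) -> mass b p A <= n.+1%:R * expR (n%:R * v).
Proof.
move=> n0 Av.
apply: (@le_trans _ _ ((\sum_(x : config n) 2 ^- n * expR (n%:R * ent (xbar x))) *
    expR (n%:R * v))); last by rewrite ler_wpM2r ?expR_ge0 ?sum_exp_ent_le.
rewrite big_distrl /= (bigID A predT) /= ler_wpDr //.
  by apply: sumr_ge0 => x _; rewrite !mulr_ge0 ?expR_ge0 ?invr_ge0 ?exprn_ge0.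
apply: ler_sum => x /Av; rewrite HE => h.
rewrite /weight -mulrA ler_wpM2l ?invr_ge0 ?exprn_ge0 // -expRD ler_expR.
by rewrite -mulrDr ler_wpM2l //; lra.
Qed.

(** Exponential tilting: the exponent is the tangent line of [ent] at [y], evaluated at the
    magnetization. *)
Lemma bern_tilt y n (x : config n) : (0 < n)%N -> -1 < y < 1 ->
  bern ((1 + y) / 2) x = 2 ^- n * expR (n%:R * (ent y + ath y * (xbar x - y))).
Proof.
move=> n0 /andP[y0 y1]; have qE : 1 - (1 + y) / 2 = (1 - y) / 2 by field.
rewrite bern_exp //; last by move=> i; rewrite qE; case: ifP => _; lra.
rewrite qE !ln_div ?posrE //; [|lra..].
set m := xbar x.
have -> : n%:R * ((1 + m) / 2 * (ln (1 + y) - ln 2) + (1 - m) / 2 * (ln (1 - y) - ln 2)) =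
    n%:R * (ent y + ath y * (m - y)) - n%:R * ln 2 by rewrite /ent /ath; field.
by rewrite expRB mulrC; congr (_^-1 * _); rewrite expRM_natl lnK // posrE.
Qed.

Definition near_pred y d n : pred (config n) := fun x => `|xbar x - y| < d.

(** A law of large numbers for the tilted measure. At distance [d] or more from [y], [ent_tangent]
    bounds the tilted probability by [2 ^- n * exp (n ent)] times [exp (- n d^2 / 2)], so the far
    part is at most [(n + 1) exp (- n d^2 / 2)]. *)
Lemma bern_near y d : -1 < y < 1 -> 0 < d ->
  exists N, forall n, (N <= n)%N ->
    1 / 2 <= \sum_(x : config n | near_pred y d x) bern ((1 + y) / 2) x.
Proof.
move=> hy d0; have [||N hN] := @poly_le_exp 2 (d ^+ 2 / 2) => //.
  by rewrite divr_gt0 ?exprn_gt0.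
exists N.+1 => n hn; have n0 : (0 < n)%N by exact: leq_ltn_trans hn.
have := bern_sum ((1 + y) / 2) n; rewrite (bigID (@near_pred y d n)) /=.
set S := \sum_(x | near_pred y d x) _; set F := \sum_(x | ~~ _) _ => SF.
suff : F <= 1 / 2 by lra.
have e0 := expR_gt0 (n%:R * (d ^+ 2 / 2)).
apply: (@le_trans _ _ (n.+1%:R * expR (- (n%:R * (d ^+ 2 / 2))))); last first.
  by rewrite expRN ler_pdivrMr //; have := hN n (ltnW hn); lra.
apply: (@le_trans _ _ ((\sum_(x : config n) 2 ^- n * expR (n%:R * ent (xbar x))) *
    expR (- (n%:R * (d ^+ 2 / 2))))); last by rewrite ler_wpM2r ?expR_ge0 ?sum_exp_ent_le.
rewrite big_distrl /= [leRHS](bigID (@near_pred y d n)) /= ler_wpDl //.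
  by apply: sumr_ge0 => x _; rewrite !mulr_ge0 ?expR_ge0 ?invr_ge0 ?exprn_ge0.
apply: ler_sum => x; rewrite -leNgt => hx.
rewrite bern_tilt // -mulrA ler_wpM2l ?invr_ge0 ?exprn_ge0 // -expRD ler_expR.
rewrite -mulrBr ler_wpM2l //.
have := ent_tangent hy (xbar_itv x).
have : d ^+ 2 <= (xbar x - y) ^+ 2.
  by rewrite -[leRHS]real_normK ?num_real // ler_pXn2r ?nnegrE ?(ltW d0).
lra.
Qed.

(** Change of measure: [n * f] is the logarithm of the ratio of [weight] to the tilted measure, and
    [f] is close to [f y = H b p y] near [y]. Half of [e] pays for this continuity, the other half
    for the factor 1/2 from [bern_near]. *)
Lemma mass_lower b p y d e : -1 < y < 1 -> 0 < d -> 0 < e ->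
  exists N, forall n, (N <= n)%N ->
    expR (n%:R * (H b p y - e)) <= mass b p (@near_pred y d n).
Proof.
move=> hy d0 e0.
pose f z := b * z ^+ p - (ent y + ath y * (z - y)).
have cf : {for y, continuous f}.
  apply: cvgB; first by apply: cvgM; [exact: cvg_cst|exact: exprn_continuous].
  apply: cvgD; first exact: cvg_cst.
  by apply: cvgM; [exact: cvg_cst|apply: cvgB; [exact: cvg_id|exact: cvg_cst]].
have fy : f y = H b p y by rewrite /f subrr mulr0 addr0 HE.
have e2 : 0 < e / 2 by lra.
have /cvgrPdist_lt/(_ _ e2)/nbhs_ballP[d1 /= d10 hd1] := cf.
pose d2 := Num.min d d1; have d20 : 0 < d2 by rewrite lt_min d0.
have [N1 hN1] := bern_near hy d20.
have [||N2 hN2] := @poly_le_exp 2 (e / 2) => //.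
exists (maxn N1 N2).+1 => n hn; have n0 : (0 < n)%N by exact: leq_ltn_trans hn.
have {hN1}h1 := hN1 n (leq_trans (leq_maxl _ _) (ltnW hn)).
have {hN2}h2 := hN2 n (leq_trans (leq_maxr _ _) (ltnW hn)).
apply: (@le_trans _ _ (mass b p (@near_pred y d2 n))); last first.
  by apply: mass_le => x /lt_le_trans; apply; rewrite ge_min lexx.
apply: (@le_trans _ _ (1 / 2 * expR (n%:R * (H b p y - e / 2)))).
  have -> : n%:R * (H b p y - e / 2) = n%:R * (H b p y - e) + n%:R * (e / 2) by field.
  rewrite expRD; have := expR_gt0 (n%:R * (H b p y - e)).
  have : 2 <= expR (n%:R * (e / 2)).
    by apply: le_trans h2; rewrite ler_peMr // ler1n.
  nra.
apply: (le_trans (ler_wpM2r (expR_ge0 _) h1)).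
rewrite big_distrl /=; apply: ler_sum => x hx.
rewrite bern_tilt // /weight -mulrA ler_wpM2l ?invr_ge0 ?exprn_ge0 // -expRD ler_expR.
rewrite -mulrDr ler_wpM2l //.
have : `|f y - f (xbar x)| < e / 2.
  apply: hd1; rewrite /ball /= distrC; apply: (lt_le_trans hx).
  by rewrite ge_min lexx orbT.
rewrite fy /f ltr_norml; lra.
Qed.

End LargeDeviations.

(** * From tail exponents to Bahadur slopes *)

Section Slope.
Context {R : realType}.
Implicit Types (p n : nat) (b c e m v y z : R).

Lemma pos_max_bound p b m x : pos_max p b m -> -1 <= x <= 1 -> H b p x <= H b p m.
Proof.
move=> [_ b0 _ _ mx] hx; apply: (le_trans (H_le_abs p x (ltW b0))).
by apply: mx; rewrite normr_ge0 ler_norml.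
Qed.

(** The threshold [N] precedes [A] and [v], since the event to be bounded will depend on the
    observed sample. [Zn] is bounded below by the mass near [m]. *)
Lemma cw_prob_upper p b m e : pos_max p b m -> 0 < e ->
  exists N, forall n, (N <= n)%N -> forall (A : pred (config n)) v,
    (forall x, A x -> H b p (xbar x) <= v) ->
    cw_prob b p A <= expR (n%:R * (v - H b p m + e)).
Proof.
move=> hm e0; have [hp b0 /andP[m0 m1] Hm mx] := hm.
have p0 : (0 < p)%N by case: (p) hp.
have e2 : 0 < e / 2 by lra.
have hm1 : -1 < m < 1 by lra.
have [N1 hN1] := mass_lower b p hm1 ltr01 e2.
have [N2 hN2] := poly_le_exp ltr01 e2.
exists (maxn N1 N2).+1 => n hn A v Av; have n0 : (0 < n)%N by exact: leq_ltn_trans hn.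
have {hN1}h1 := hN1 n (leq_trans (leq_maxl _ _) (ltnW hn)).
have {hN2}h2 := hN2 n (leq_trans (leq_maxr _ _) (ltnW hn)).
rewrite cw_probE // ler_pdivrMr ?Zn_gt0 //.
apply: (le_trans (mass_upper n0 Av)).
have hZ : expR (n%:R * (H b p m - e / 2)) <= Zn b p n.
  by rewrite Zn_mass //; apply: (le_trans h1); exact: mass_le.
apply: (le_trans _ (ler_wpM2l (expR_ge0 _) hZ)).
rewrite -expRD.
have -> : n%:R * (v - H b p m + e) + n%:R * (H b p m - e / 2) =
  n%:R * (e / 2) + n%:R * v by field.
by rewrite expRD ler_wpM2r ?expR_ge0 //; lra.
Qed.

Lemma cw_prob_lower p b m y d e : pos_max p b m -> -1 < y < 1 -> 0 < d -> 0 < e ->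
  exists N, forall n, (N <= n)%N -> forall (A : pred (config n)),
    (forall x, near_pred y d x -> A x) ->
    expR (n%:R * (H b p y - H b p m - e)) <= cw_prob b p A.
Proof.
move=> hm hy d0 e0; have [hp b0 /andP[m0 m1] Hm mx] := hm.
have p0 : (0 < p)%N by case: (p) hp.
have e2 : 0 < e / 2 by lra.
have [N1 hN1] := mass_lower b p hy d0 e2.
have [N2 hN2] := poly_le_exp ltr01 e2.
exists (maxn N1 N2).+1 => n hn A Av; have n0 : (0 < n)%N by exact: leq_ltn_trans hn.
have {hN1}h1 := hN1 n (leq_trans (leq_maxl _ _) (ltnW hn)).
have {hN2}h2 := hN2 n (leq_trans (leq_maxr _ _) (ltnW hn)).
rewrite cw_probE // ler_pdivlMr ?Zn_gt0 //.
apply: (le_trans _ (le_trans h1 (mass_le b p Av))).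
have hZ : Zn b p n <= expR (n%:R * (e / 2)) * expR (n%:R * H b p m).
  rewrite Zn_mass //; apply: (@le_trans _ _ (n.+1%:R * expR (n%:R * H b p m))).
    by apply: mass_upper => // x _; apply: (pos_max_bound hm); exact: xbar_itv.
  by rewrite ler_wpM2r ?expR_ge0 //; lra.
apply: (le_trans (ler_wpM2l (expR_ge0 _) hZ)).
by rewrite -!expRD ler_expR le_eqVlt; apply/orP; left; apply/eqP; field.
Qed.

(* The observables depend on the magnetization only through [fold]: the model
   is invariant under [x |-> - x] when [p] is even. *)
Definition fold p y : R := if odd p then y else `|y|.

Lemma foldX p y : fold p y ^+ p = y ^+ p.
Proof.
rewrite /fold; case: ifP => // po; have [h|h] := leP 0 y; first by rewrite ger0_norm.
by rewrite ltr0_norm // exprNn -signr_odd po mul1r.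
Qed.

Lemma H_fold b p y : H b p (fold p y) = H b p y.
Proof.
rewrite !HE foldX /fold; case: ifP => // _; have [h|h] := leP 0 y.
  by rewrite ger0_norm.
by rewrite ltr0_norm // entN.
Qed.

Lemma fold_itv p y : -1 <= y <= 1 -> -1 <= fold p y <= 1.
Proof.
move=> hy; rewrite /fold; case: ifP => // _.
by rewrite (le_trans _ (normr_ge0 _)) ?lerN10 //= ler_norml.
Qed.

Lemma fold_id p y : 0 <= y -> fold p y = y.
Proof. by move=> y0; rewrite /fold ger0_norm ?if_same. Qed.

Lemma H_fold_neg b p y : 0 <= b -> -1 <= y <= 1 -> fold p y <= 0 -> (0 < p)%N -> H b p y <= 0.
Proof.
move=> b0 hy fy p0; rewrite HE; have := ent_ge0 hy.
suff : b * y ^+ p <= 0 by lra.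
rewrite -foldX mulr_ge0_le0 //; move: fy; rewrite /fold; case: ifP => po.
  move=> y0; rewrite -[y]opprK exprNn -signr_odd po mulN1r oppr_le0.
  by rewrite exprn_ge0 // oppr_ge0.
rewrite normr_le0 => /eqP->; rewrite normr0 expr0n; by case: (p) p0.
Qed.

(** Left of the window the gap comes from compactness and uniqueness of the maximizer, right of it
    from monotonicity, and for nonpositive folded values from [H <= 0 < H b p m]. *)
Lemma pos_max_gap p b m d : pos_max p b m -> 0 < d ->
  exists2 v, v < H b p m & forall y, -1 <= y <= 1 ->
    ~~ (`|fold p y - m| < d) -> H b p y <= v.
Proof.
move=> hm d0; have [hp b0 /andP[m0 m1] Hm mx] := hm.
have p0 : (0 < p)%N by case: (p) hp.
have [v1 v1m hv1] : exists2 v, v < H b p m & forall z, 0 <= z <= m - d -> H b p z <= v.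
  have [md|md] := leP 0 (m - d); last by exists 0 => // z hz; lra.
  have cH : {within `[0, m - d], continuous (H b p)}.
    exact/continuous_subspaceT/continuous_H.
  have [z] := EVT_max md cH; rewrite in_itv /= => /andP[z0 z1] zx.
  exists (H b p z); first by apply: (pos_max_lt hm); lra.
  by move=> t ht; apply: zx; rewrite in_itv.
have [v2 v2m hv2] : exists2 v, v < H b p m & forall z, m + d <= z <= 1 -> H b p z <= v.
  have [md|md] := leP (m + d) 1; last by exists 0 => // z hz; lra.
  exists (H b p (m + d)); first by apply: (H_decr_right hm); lra.
  by move=> z hz; apply: (H_decr_right_le hm); lra.
exists (Num.max 0 (Num.max v1 v2)); first by rewrite !gt_max Hm v1m.
move=> y hy; rewrite -leNgt !le_max => far.
have [f0|f0] := leP (fold p y) 0; first by rewrite H_fold_neg // ltW.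
have /andP[_ f1] := fold_itv p hy.
rewrite -(H_fold b p y); apply/orP; right; apply/orP.
move: far; rewrite real_ler_normr ?num_real // => /orP[h|h].
  by right; apply: hv2; lra.
by left; apply: hv1; lra.
Qed.

Lemma cw_concentration p b m d e : pos_max p b m -> 0 < d -> 0 < e ->
  exists N, forall n, (N <= n)%N ->
    cw_prob b p (fun x : config n => ~~ (`|fold p (xbar x) - m| < d)) < e.
Proof.
move=> hm d0 e0; have [v vm hv] := pos_max_gap hm d0.
have e2 : 0 < (H b p m - v) / 2 by lra.
have [N1 hN1] := cw_prob_upper hm e2.
have ie : 0 < 2 / e by rewrite divr_gt0.
have [N2 hN2] := poly_le_exp ie e2.
exists (maxn N1 N2) => n hn.
have {hN2}h2 := hN2 n (leq_trans (leq_maxr _ _) hn).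
apply: (le_lt_trans (hN1 n (leq_trans (leq_maxl _ _) hn) _ v _)).
  by move=> x; apply: hv; exact: xbar_itv.
have -> : n%:R * (v - H b p m + (H b p m - v) / 2) = - (n%:R * ((H b p m - v) / 2)) by field.
rewrite expRN invf_plt ?posrE ?expR_gt0 //.
apply: (lt_le_trans _ h2).
have : 0 < e^-1 by rewrite invr_gt0.
have : 1 <= n.+1%:R :> R by rewrite ler1n.
nra.
Qed.

Lemma test_stat_le (est : estimator) b0 n (x y : config n) : (0 < n)%N ->
  (test_stat est b0 y <= test_stat est b0 x)%E = (est n y <= est n x)%E.
Proof.
move=> n0; rewrite /test_stat lee_pmul2l //; last by rewrite lte_fin sqrtr_gt0 ltr0n.
by rewrite leeD2rE.
Qed.

(** Centering by a finite [b0] and scaling by [sqrt n > 0] preserve the order, so the p-value is the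
    probability of a strictly larger estimate. *)
Lemma LnE (est : estimator) b0 p n (x : config n) : (0 < p)%N -> (0 < n)%N ->
  Ln est b0 p x = cw_prob b0 p (fun y : config n => est n x < est n y)%E.
Proof.
move=> p0 n0; rewrite /Ln /cw_cdf cw_probC //; apply: eq_bigl => y /=.
by rewrite test_stat_le // ltNge.
Qed.

(** With two limits, the deviation events of size [|c1 - c2| / 4] would cover the whole space,
    although each eventually has probability below 1/2. Infinite values of [Y] lie in both
    events. *)
Lemma cvg_in_prob_unique b p (Y : estimator) c1 c2 : (0 < p)%N ->
  cvg_in_prob b p Y c1 -> cvg_in_prob b p Y c2 -> c1 = c2.
Proof.
move=> p0 h1 h2; apply/eqP/negP => /negP c12.
pose e := `|c1 - c2| / 2.
have e0 : 0 < e by rewrite divr_gt0 // normr_gt0 subr_eq0.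
pose e' := e / 2; have e'0 : 0 < e' by rewrite divr_gt0.
have half : 0 < (1 / 2 : R) by lra.
have /cvgrPdist_lt/(_ _ half)[N1 _ hN1] := h1 _ e'0.
have /cvgrPdist_lt/(_ _ half)[N2 _ hN2] := h2 _ e'0.
pose n := maxn N1 N2.
have := hN1 n (leq_maxl _ _); have := hN2 n (leq_maxr _ _).
rewrite /= !sub0r !normrN !ger0_norm ?cw_prob_ge0 // => P2 P1.
have := @cw_prob_or _ b p n predT
  (fun x => e'%:E < `|Y n x - c1%:E|)%E (fun x => e'%:E < `|Y n x - c2%:E|)%E p0.
rewrite cw_probT // => /(_ _)/wrap[x _|]; last by lra.
apply/negPn/negP; rewrite negb_or -!leNgt => /andP[].
case: (Y n x) => [r| |] //=; rewrite !lee_fin => hr1 hr2.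
have : `|c1 - c2| <= `|r - c1| + `|r - c2|.
  by rewrite (distrC r c1) (le_trans _ (ler_normD _ _)) // addrA subrK.
have := e0; rewrite /e' /e in hr1 hr2 *; lra.
Qed.

(** The deterministic input to the slope: for samples near [m1], the event of a larger estimate lies
    in [H <= v + e] and contains a window around a point [y] with [H >= v - e]. *)
Definition tail_exponent (est : @estimator R) p b0 m1 v := forall e, 0 < e ->
  exists (d y dy : R) (N : nat), [/\ 0 < d, -1 < y < 1, 0 < dy, v - e <= H b0 p y &
    forall n, (N <= n)%N -> forall x : config n, `|fold p (xbar x : R) - m1| < d ->
      (forall z : config n, (est n x < est n z)%E -> H b0 p (xbar z) <= v + e) /\
      (forall z : config n, near_pred y dy z -> (est n x < est n z)%E)].

(** On the concentration event under [b], the large deviation bounds under [b0] squeeze the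
    normalized logarithm to within [2 eps / 3] of [v - H b0 p m0]. Uniqueness of the limit
    identifies the value chosen by [xget]. *)
Lemma bahadur_slopeE (est : estimator) p b0 b m0 m1 v :
  pos_max p b0 m0 -> pos_max p b m1 -> tail_exponent est p b0 m1 v ->
  bahadur_slope est b0 b p = 2 * (H b0 p m0 - v).
Proof.
move=> h0 h1 hT; have [hp _ _ _ _] := h0.
have p0 : (0 < p)%N by case: (p) hp.
have slope : is_bahadur_slope est b0 b p (2 * (H b0 p m0 - v)).
  move=> eps eps0; have e0 : 0 < eps / 3 by lra.
  have [d [y [dy [N1 [d0 hy dy0 vy hx]]]]] := hT _ e0.
  have [N2 hN2] := cw_prob_upper h0 e0.
  have [N3 hN3] := cw_prob_lower h0 hy dy0 e0.
  apply/cvgrPdist_lt => e' e'0.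
  have [N4 hN4] := cw_concentration h1 d0 e'0.
  exists (maxn (maxn N1 N2) (maxn N3 N4)).+1 => // n /= hn.
  have n0 : (0 < n)%N by exact: leq_ltn_trans hn.
  move/ltnW: hn; rewrite !geq_max => /andP[/andP[n1 n2] /andP[n3 n4]].
  rewrite sub0r normrN ger0_norm ?cw_prob_ge0 //.
  apply: (le_lt_trans (cw_prob_le _ p0 _) (hN4 n n4)) => x.
  apply: contraTN => /(hx n n1)[up low].
  rewrite -leNgt LnE //; set L := cw_prob _ _ _.
  have L1 : L <= expR (n%:R * (v + eps / 3 - H b0 p m0 + eps / 3)) by exact: hN2.
  have L2 : expR (n%:R * (H b0 p y - H b0 p m0 - eps / 3)) <= L by exact: hN3.
  have L0 : 0 < L by apply: lt_le_trans L2; exact: expR_gt0.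
  rewrite (lt_geF L0) /= lee_fin.
  have nR : 0 < n%:R :> R by rewrite ltr0n.
  have l1 : n%:R^-1 * ln L <= v + eps / 3 - H b0 p m0 + eps / 3.
    by rewrite mulrC ler_pdivrMr // mulrC -[leRHS]expRK ler_ln ?posrE ?expR_gt0.
  have l2 : H b0 p y - H b0 p m0 - eps / 3 <= n%:R^-1 * ln L.
    by rewrite [leRHS]mulrC ler_pdivlMr // mulrC -[leLHS]expRK ler_ln ?posrE ?expR_gt0.
  by rewrite ler_norml; lra.
apply: xget_unique => // c hc.
have := cvg_in_prob_unique p0 hc slope; lra.
Qed.

End Slope.

(** * The two estimators *)

Section Mple.
Context {R : realType}.
Implicit Types (p n : nat) (b c e m v : R).

Lemma athN (t : R) : ath (- t) = - ath t.
Proof. by rewrite /ath opprK -mulrN opprB. Qed.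

(** For even [p] and negative magnetization, both [ath] and the power [p - 1] are odd, so their
    quotient is even. *)
Lemma mple_fold p n (x : config n) : (0 < p)%N -> 0 < fold p (xbar x : R) < 1 ->
  mple p x = (mpl_fun p (fold p (xbar x : R)))%:E.
Proof.
move=> p0; rewrite /mple; set t : R := xbar x => ht.
have t0 : t != 0.
  by apply: contraTneq ht => ->; rewrite /fold normr0 if_same ltxx.
have t1 : -1 < t < 1.
  move: ht; rewrite /fold; case: ifP => _ ht; first lra.
  by rewrite -ltr_norml; case/andP: ht.
rewrite (negbTE t0) /atanhe.
have -> : (t == 1) = false by apply/eqP; lra.
have -> : (t == -1) = false by apply/eqP; lra.
rewrite -EFinM ln_div ?posrE; [|lra..].
rewrite -[2^-1 * _]/(ath t); congr EFin.
have -> : p%:R^-1 * t ^- (p - 1) * ath t = mpl_fun p t.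
  by rewrite /mpl_fun -invfM mulrC subn1.
rewrite /fold; case: ifP => // po; have [h|h] := leP 0 t; first by rewrite ger0_norm.
rewrite ltr0_norm // /mpl_fun athN exprNn -signr_odd.
have -> : odd p.-1 by case: (p) p0 po => //= k _ /negbFE.
by rewrite expr1 mulN1r mulrN invrN mulrNN.
Qed.

(** Samples are kept within [d] of [m1]; the margin [2 * d] leaves room to their right for a window
    of larger magnetizations. *)
Lemma near_radius p b0 b m0 m1 e : pos_max p b0 m0 -> pos_max p b m1 ->
  b0 < b -> 0 < e ->
  exists d : R, [/\ 0 < d, m0 < m1 - d, m1 + 2 * d < 1 &
    forall t, `|t - m1| <= 2 * d -> `|H b0 p t - H b0 p m1| < e].
Proof.
move=> h0 h1 b0b e0; have m01 := pos_max_arg_lt h0 h1 b0b.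
have [_ _ /andP[m1p m1l] _ _] := h1.
have /cvgrPdist_lt/(_ _ e0)/nbhs_ballP[d1 /= d10 hd1] := @continuous_H R b0 p m1.
pose d := Num.min d1 (Num.min (m1 - m0) (1 - m1)) / 3.
have d0 : 0 < d by rewrite divr_gt0 // !lt_min d10 !subr_gt0 m01.
have : 3 * d <= Num.min d1 (Num.min (m1 - m0) (1 - m1)) by rewrite /d; lra.
rewrite !le_min => /and3P[l1 l2 l3].
exists d; split => //; [lra..|] => t ht.
rewrite distrC; apply: hd1; rewrite /ball /= distrC; lra.
Qed.

Lemma H_upper p b0 m0 (u : R) n (z : config n) : pos_max p b0 m0 -> m0 <= u ->
  u <= fold p (xbar z) -> H b0 p (xbar z) <= H b0 p u.
Proof.
move=> h0 m0u uz; rewrite -(H_fold b0 p (xbar z)).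
have /andP[_ z1] : -1 <= fold p (xbar z : R) <= 1 by exact/fold_itv/xbar_itv.
exact: (H_decr_right_le h0).
Qed.

Lemma tail_exponent_mple p b0 b m0 m1 : pos_max p b0 m0 -> pos_max p b m1 ->
  b0 < b -> tail_exponent (mple p) p b0 m1 (Num.max 0 (H b0 p m1)).
Proof.
move=> h0 h1 b0b e e0; have [d [d0 dm0 d1 hd]] := near_radius h0 h1 b0b e0.
have m01 := pos_max_arg_lt h0 h1 b0b.
have [hp b00 /andP[m00 m0l] _ _] := h0; have [_ bp /andP[m1p m1l] _ _] := h1.
have p0 : (0 < p)%N by case: (p) hp.
have up n (x z : config n) : `|fold p (xbar x : R) - m1| < d ->
    (mple p x < (mple p z : \bar R))%E -> H b0 p (xbar z) <= Num.max 0 (H b0 p m1) + e.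
  rewrite ltr_norml => hx xz; set v := Num.max _ _.
  have [v0 vm] : 0 <= v /\ H b0 p m1 <= v by rewrite !le_max !lexx orbT.
  (* Three positions of [z]: nonpositive, where [H <= 0]; beyond [m1 - d], where [H] decreases from
     a value close to [H b0 p m1]; and the left branch between, where [H_neg_left] applies. *)
  have [f0|f0] := leP (fold p (xbar z : R)) 0.
    by rewrite (le_trans (H_fold_neg (ltW b00) (xbar_itv z) f0 p0)) // addr_ge0 // ltW.
  have [fm|fm] := leP (m1 - d) (fold p (xbar z)).
    have := hd (m1 - d); have := H_upper h0 (ltW dm0) fm.
    rewrite addrAC subrr add0r normrN gtr0_norm // ltr_norml => hz /(_ ltac:(lra)).
    lra.
  move: xz; rewrite !mple_fold //; [|lra..]; rewrite lte_fin => xz.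
  have hM : fold p (xbar z) < fold p (xbar x) :> R by lra.
  have hm0 : m0 <= fold p (xbar x : R) by lra.
  have hx1 : fold p (xbar x : R) < 1 by lra.
  by have := H_neg_left h0 f0 hM hm0 hx1 xz; rewrite H_fold; lra.
move: up; have [v0|v0] := leP 0 (H b0 p m1) => up.
  exists d, (m1 + 3 / 2 * d), (d / 2), 0%N; split => //; [lra|lra| |].
    have := hd (m1 + 3 / 2 * d).
    have -> : m1 + 3 / 2 * d - m1 = 3 / 2 * d by ring.
    by rewrite gtr0_norm ?ltr_norml; [move=> /(_ ltac:(lra)); lra|lra].
  move=> n _ x hx; split => [z|z]; first exact: up.
  rewrite /near_pred ltr_norml => hz; move: hx; rewrite ltr_norml => hx.
  have z0 : 0 <= xbar z :> R by lra.
  rewrite !mple_fold ?(fold_id _ z0) //; [|lra..].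
  by rewrite lte_fin (mpl_fun_mono h0); lra.
have gp : 0 < mpl_fun p (m1 + d).
  rewrite (lt_trans bp) // -(mpl_fun_max h1) (mpl_fun_incr h1); lra.
have [d2 /andP[d20 d21] hd2] := mpl_fun_near0 hp gp.
have /cvgrPdist_lt/(_ _ e0)/nbhs_ballP[d3 /= d30 hd3] := @continuous_H R b0 p 0.
pose y := Num.min d2 d3 / 2.
have y0 : 0 < y by rewrite divr_gt0 // lt_min d20.
have : 2 * y <= Num.min d2 d3 by rewrite /y; lra.
rewrite le_min => /andP[y2 y3].
exists d, y, y, 0%N; split => //; [lra| |].
  have : ball 0 d3 y.
    by rewrite /ball /= sub0r normrN gtr0_norm //; lra.
  by move/hd3; rewrite (H_at0 b0 p0) ltr_norml; lra.
move=> n _ x hx; split => [z|z]; first exact: up.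
rewrite /near_pred ltr_norml => hz; move: hx; rewrite ltr_norml => hx.
have z0 : 0 <= xbar z :> R by lra.
rewrite !mple_fold ?(fold_id _ z0) //; [|lra..].
rewrite lte_fin; apply: (lt_trans _ (hd2 _ _)); last by lra.
by rewrite (mpl_fun_mono h0); lra.
Qed.

End Mple.

Section Mle.
Context {R : realType}.
Implicit Types (p n : nat) (b c e m r s : R).

(** * Minimizers of the reciprocal likelihood, a finite sum of exponentials *)

Section InverseLikelihood.
Context {T : finType} (A : T -> R).
Implicit Types (t u : T).

Definition invlik t r : R := \sum_u expR (r * (A u - A t)).

Lemma invlik_shift t u r : invlik t r = expR (r * (A u - A t)) * invlik u r.
Proof.
rewrite /invlik big_distrr /=; apply: eq_bigr => w _.
by rewrite -expRD; congr expR; ring.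
Qed.

Lemma invlik_ge t u r : expR (r * (A u - A t)) <= invlik t r.
Proof.
by rewrite /invlik (bigD1 u) //= lerDl; apply: sumr_ge0 => w _; exact: expR_ge0.
Qed.

Lemma invlik_ge1 t r : 1 <= invlik t r.
Proof. by have := invlik_ge t t r; rewrite subrr mulr0 expR0. Qed.

Lemma invlik_gt0 t r : 0 < invlik t r.
Proof. exact: lt_le_trans (invlik_ge1 t r). Qed.

Lemma is_derive_expRM c r : is_derive r 1 (fun r => expR (r * c)) (expR (r * c) * c).
Proof.
have d : is_derive r 1 (fun r : R => r * c) c.
  have -> : (fun r : R => r * c) = c *: id by apply/funext => s; rewrite mulrC.
  by apply: is_derive_eq; rewrite /GRing.scale /= mulr1.
exact: (@is_derive1_comp R (@expR R) (fun r => r * c) r _ _ (is_derive_expR _) d).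
Qed.

Lemma derivable_invlik t r : derivable (invlik t) r 1.
Proof.
rewrite /invlik; elim: (index_enum T) => [|u s IH].
  have -> : (fun r : R => \sum_(u <- [::]) expR (r * (A u - A t))) = cst 0.
    by apply/funext => q; rewrite big_nil.
  exact: derivable_cst.
have -> : (fun r : R => \sum_(w <- u :: s) expR (r * (A w - A t))) =
    (fun r => expR (r * (A u - A t))) + (fun r => \sum_(w <- s) expR (r * (A w - A t))).
  by apply/funext => q; rewrite big_cons.
by apply: derivableD.
Qed.

Lemma continuous_invlik t : continuous (invlik t).
Proof.
by move=> r; apply/differentiable_continuous; rewrite -derivable1_diffP; exact: derivable_invlik.
Qed.

Definition inv_min t r := forall s, invlik t r <= invlik t s.

(** With [k = A t - A u], minimality for [t] gives [invlik t r <= invlik t s], and minimality for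
    [u] gives the reverse comparison weighted by [exp (s k)] and [exp (r k)]; together
    [exp (s k) <= exp (r k)]. *)
Lemma inv_min_le t u r s : A u < A t -> inv_min t r -> inv_min u s -> s <= r.
Proof.
move=> ut hr hs; have := hs r; rewrite !(invlik_shift u t).
have := hr s; set k := A t - A u; have k0 : 0 < k by rewrite subr_gt0.
have := invlik_gt0 t s; have := invlik_gt0 t r; move: (invlik t r) (invlik t s) => f g f0 g0 fg.
move=> h; have {}h : expR (s * k) * g <= expR (r * k) * g.
  by apply: (le_trans h); rewrite ler_wpM2l ?expR_ge0.
by move: h; rewrite ler_pM2r // ler_expR ler_pM2r.
Qed.

Lemma inv_min_derive t r : inv_min t r -> is_derive r 1 (invlik t) 0.
Proof.
move=> hr; apply: (@derive1_at_min _ _ (r - 1) (r + 1)) => //; first lra.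
  by move=> s _; exact: derivable_invlik.
by rewrite in_itv /=; lra.
Qed.

(** At a common minimizer both derivatives vanish, yet [invlik u] is [invlik t] times an exponential
    whose derivative is positive. *)
Lemma inv_min_neq t u r : A u < A t -> inv_min t r -> ~ inv_min u r.
Proof.
move=> ut hr hu; have dt := inv_min_derive hr; have du := inv_min_derive hu.
have de := is_derive_expRM (A t - A u) r.
have E : invlik u = (fun r => expR (r * (A t - A u))) * invlik t.
  by apply/funext => s; exact: invlik_shift.
have du' : is_derive r 1 (invlik u) (invlik t r * (expR (r * (A t - A u)) * (A t - A u))).
  by rewrite E; apply: is_derive_eq; rewrite scaler0 add0r.
have := @derive_val _ _ _ _ _ _ _ du; rewrite (@derive_val _ _ _ _ _ _ _ du').
apply/eqP; rewrite lt0r_neq0 // mulr_gt0 ?invlik_gt0 // mulr_gt0 ?expR_gt0 //.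
by rewrite subr_gt0.
Qed.

(** The term of [w] grows for positive [s] and that of [u] for negative [s], so outside [[-B, B]]
    the sum exceeds its value at 0, and the extreme value theorem applies inside. *)
Lemma inv_min_exists t u w : A u < A t -> A t < A w -> exists r, inv_min t r.
Proof.
move=> ut tw; pose a := Num.min (A t - A u) (A w - A t).
have a0 : 0 < a by rewrite lt_min !subr_gt0 ut.
have [au aw] : a <= A t - A u /\ a <= A w - A t by rewrite !ge_min !lexx orbT.
pose B := invlik t 0 / a; have B0 : 0 < B by rewrite divr_gt0 ?invlik_gt0.
have aB : B * a = invlik t 0 by rewrite divfK // lt0r_neq0.
have out s : B <= `|s| -> invlik t 0 <= invlik t s.
  move=> Bs; rewrite -aB; have [s0|s0] := leP 0 s.
    rewrite ger0_norm // in Bs.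
    apply: (le_trans _ (invlik_ge t w s)); apply: (le_trans _ (expR_ge1Dx _)).
    nra.
  rewrite ltr0_norm // in Bs.
  apply: (le_trans _ (invlik_ge t u s)); apply: (le_trans _ (expR_ge1Dx _)).
  nra.
have NBB : - B <= B by lra.
have [r _ hr] := EVT_min NBB (continuous_subspaceT (@continuous_invlik t)).
exists r => s; have [sB|Bs] := leP `|s| B.
  by apply: hr; rewrite in_itv /= -ler_norml.
apply: (le_trans _ (out s (ltW Bs))); apply: hr; rewrite in_itv /=; lra.
Qed.

Lemma invlik_unbounded t w c : A t < A w -> exists M, forall s, M < s -> c < invlik t s.
Proof.
move=> tw; exists (`|c| / (A w - A t)) => s; rewrite ltr_pdivrMr ?subr_gt0 // => cs.
apply: (lt_le_trans _ (invlik_ge t w s)); apply: (lt_le_trans _ (expR_ge1Dx _)).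
by have := ler_norm c; lra.
Qed.

Lemma invlik_homo t r s : (forall u, A t <= A u) -> r <= s -> invlik t r <= invlik t s.
Proof.
move=> tmin rs; apply: ler_sum => u _; rewrite ler_expR ler_wpM2r // subr_ge0.
exact: tmin.
Qed.

End InverseLikelihood.

Lemma cw_pmf_invlik p n (x : config n) r :
  cw_pmf r p x = (invlik (fun z : config n => cw_hamiltonian p z) x r)^-1.
Proof.
rewrite /cw_pmf /Zn mulVKf; last by rewrite expf_neq0 // pnatr_eq0.
rewrite -[expR _]invrK -invfM; congr (_^-1); rewrite big_distrr /=.
by apply: eq_bigr => z _; rewrite -expRN -expRD mulrBr addrC.
Qed.

(** * Order of the maximum likelihood estimates against the Hamiltonian *)

Section MleOrder.
Context {p n : nat}.
Implicit Types (x y z : config n).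
Let A : config n -> R := fun z => cw_hamiltonian p z.

Lemma attained_inv_min x r :
  (forall s, cw_pmf s p x <= cw_pmf r p x) <-> inv_min A x r.
Proof.
split=> h s; have := h s; rewrite !cw_pmf_invlik lef_pV2 ?posrE ?invlik_gt0 //.
Qed.

Lemma pmf_has_ubound x : has_ubound (range (fun s : R => cw_pmf s p x)).
Proof.
exists 1 => _ [s _ <-]; rewrite cw_pmf_invlik invf_le1 ?invlik_gt0 //.
exact: invlik_ge1.
Qed.

(** The term of [z] sends the likelihood of [x] to 0 at plus infinity, while its supremum is
    positive. *)
Lemma is_mle_neq_pinfty x z : A x < A z -> ~ is_mle p x (+oo%E : \bar R).
Proof.
move=> xz [_]; set S := sup _ => cS.
have S0 : 0 < S.
  apply: (@lt_le_trans _ _ (cw_pmf 0 p x)); first by rewrite cw_pmf_invlik invr_gt0 invlik_gt0.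
  by apply: (ub_le_sup (pmf_has_ubound x)); exists 0.
have S2 : 0 < S / 2 by rewrite divr_gt0.
have /cvgrPdist_lt/(_ _ S2)[M [_ hM]] := cS.
have [M' hM'] := invlik_unbounded (2 / S) xz.
pose s := Num.max M M' + 1.
have sM : M < s /\ M' < s.
  have : M <= Num.max M M' /\ M' <= Num.max M M' by rewrite !le_max !lexx orbT.
  by rewrite /s; lra.
have /= := hM s sM.1; have := hM' s sM.2; rewrite cw_pmf_invlik.
move: (invlik_gt0 A x s); set D := invlik _ _ _ => D0 hD.
have : D^-1 < S / 2 by rewrite invf_plt ?posrE // invf_div.
by rewrite ltr_norml; lra.
Qed.

(** If some configuration has a smaller Hamiltonian, the maximum is attained. Otherwise the
    likelihood is nonincreasing, so its supremum is attained or approached at minus infinity. *)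
Lemma is_mle_exists x z : A x < A z -> exists v : \bar R, is_mle p x v.
Proof.
move=> xz; have [[u ux]|nu] := pselect (exists u, A u < A x).
  by have [r hr] := inv_min_exists ux xz; exists r%:E; exact/attained_inv_min.
have xmin u : A x <= A u by rewrite leNgt; apply/negP => h; apply: nu; exists u.
have [[r hr]|nr] := pselect (exists r : R, forall s, cw_pmf s p x <= cw_pmf r p x).
  by exists r%:E.
exists -oo%E; split => //; apply/cvgrPdist_lt => e e0.
have hs : has_sup (range (fun s : R => cw_pmf s p x)).
  by split; [exists (cw_pmf 0 p x); exists 0|exact: pmf_has_ubound].
have [_ [r _ <-] hr] := sup_adherent e0 hs.
exists r; split; first exact: num_real.
move=> s /= sr; have le_sup : cw_pmf s p x <= sup (range (fun s : R => cw_pmf s p x)).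
  by apply: (ub_le_sup (pmf_has_ubound x)); exists s.
have : cw_pmf r p x <= cw_pmf s p x.
  by rewrite !cw_pmf_invlik lef_pV2 ?posrE ?invlik_gt0 // invlik_homo // ltW.
by rewrite ger0_norm ?subr_ge0 //; lra.
Qed.

Lemma mle_interior x u w : A u < A x -> A x < A w ->
  exists2 r, mle p x = r%:E & inv_min A x r.
Proof.
move=> ux xw; have [r0 hr0] := inv_min_exists ux xw.
have : is_mle p x (mle p x : \bar R) by apply: xgetPex; exact: is_mle_exists xw.
case: (mle p x) => [r hr||].
- by exists r => //; exact/attained_inv_min.
- by move=> [[]]; exists r0; exact/attained_inv_min.
- by move=> [[]]; exists r0; exact/attained_inv_min.
Qed.

Lemma mle_lt x y u w v : A u < A x -> A x < A w -> A x < A y -> A y < A v ->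
  (mle p x < (mle p y : \bar R))%E.
Proof.
move=> ux xw xy yv.
have [r -> hr] := mle_interior ux xw.
have [s -> hs] := mle_interior xy yv.
rewrite lte_fin lt_neqAle (inv_min_le xy hs hr) andbT.
by apply/eqP => rs; apply: (inv_min_neq xy hs); rewrite -rs.
Qed.

Lemma lt_mle x y u w : A u < A x -> A x < A w ->
  (mle p x < (mle p y : \bar R))%E -> A x < A y.
Proof.
move=> ux xw xy; rewrite ltNge; apply/negP; rewrite le_eqVlt => /orP[/eqP yx|yx].
  (* Equal Hamiltonians give the same likelihood function, hence the same predicate under [xget] and
     the same choice. *)
  suff E : mle p x = (mle p y : \bar R) by move: xy; rewrite E ltxx.
  have pE s : cw_pmf s p x = cw_pmf s p y.
    by rewrite /cw_pmf -/(A x) -/(A y) yx.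
  rewrite /mle; congr xget; apply/funext => v; rewrite /is_mle.
  have -> : (fun s => cw_pmf s p x) = (fun s => cw_pmf s p y).
    by apply/funext => s; exact: pE.
  have E r : (forall s, cw_pmf s p x <= cw_pmf r p x) =
      (forall s, cw_pmf s p y <= cw_pmf r p y).
    by apply/propext; split=> h s; [rewrite -!pE|rewrite !pE].
  have E' : (exists r, forall s, cw_pmf s p x <= cw_pmf r p x) =
      (exists r, forall s, cw_pmf s p y <= cw_pmf r p y).
    by apply/propext; split=> -[r h]; exists r; [rewrite -E|rewrite E].
  by case: v => [r||]; rewrite ?E ?E'.
have yw := lt_trans yx xw.
move: xy; have [r -> hr] := mle_interior ux xw.
have : is_mle p y (mle p y : \bar R) by apply: xgetPex; exact: is_mle_exists yw.
case: (mle p y) => [s /attained_inv_min hs|/(is_mle_neq_pinfty yw)//|//].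
by rewrite lte_fin ltNge (inv_min_le yx hr hs).
Qed.

End MleOrder.

Lemma exists_near p (y d : R) : -1 < y < 1 -> 0 < d ->
  exists N, forall n, (N <= n)%N -> exists x : config n, near_pred y d x.
Proof.
move=> hy d0; have [N hN] := @mass_lower R 0 0 y d 1 hy d0 ltr01.
exists N => n /hN h; apply: contrapT => nx; move: h; apply/negP; rewrite -ltNge.
rewrite /mass big_pred0 ?expR_gt0 // => x; apply/negbTE/negP => hx.
by apply: nx; exists x.
Qed.

Lemma tail_exponent_mle p b0 b m0 m1 : pos_max p b0 m0 -> pos_max p b m1 ->
  b0 < b -> tail_exponent (mle p) p b0 m1 (H b0 p m1).
Proof.
move=> h0 h1 b0b e e0; have [d [d0 dm0 d1 hd]] := near_radius h0 h1 b0b e0.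
have [hp b00 /andP[m00 m0l] _ _] := h0; have [_ bp /andP[m1p m1l] _ _] := h1.
have p0 : (0 < p)%N by case: (p) hp.
(* A configuration [u] of magnetization below [m0] in absolute value and the all-plus [w] enclose
   the Hamiltonian of [x], so its estimate is finite. *)
have [N hN] := @exists_near p 0 m0 ltac:(lra) m00.
exists d, (m1 + 3 / 2 * d), (d / 2), N.+1; split => //; [lra|lra| |].
  have := hd (m1 + 3 / 2 * d); have -> : m1 + 3 / 2 * d - m1 = 3 / 2 * d by ring.
  by rewrite gtr0_norm ?ltr_norml; [move=> /(_ ltac:(lra)); lra|lra].
move=> n hn x; rewrite ltr_norml => hx.
have n0 : (0 < n)%N by exact: leq_ltn_trans hn.
have nR : 0 < n%:R :> R by rewrite ltr0n.
have [u hu] := hN n (ltnW hn).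
have hamE (z : config n) : cw_hamiltonian p z = n%:R * fold p (xbar z) ^+ p :> R.
  by rewrite cw_hamiltonianE // foldX.
have ham_lt (z z' : config n) : 0 <= fold p (xbar z : R) -> 0 <= fold p (xbar z' : R) ->
    (cw_hamiltonian p z < cw_hamiltonian p z' :> R) =
    (fold p (xbar z) < fold p (xbar z') :> R).
  by move=> z0 z'0; rewrite !hamE ltr_pM2l // ltr_pXn2r.
have fx0 : 0 <= fold p (xbar x : R) by lra.
pose w : config n := [ffun=> true].
have xw : xbar w = 1 :> R.
  rewrite /xbar (eq_bigr (fun=> 1)) => [|i _]; last by rewrite /spin ffunE.
  by rewrite sumr_const card_ord divff // lt0r_neq0.
have fw : fold p (xbar w : R) = 1 by rewrite xw fold_id.
have ux : cw_hamiltonian p u < cw_hamiltonian p x :> R.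
  rewrite !hamE ltr_pM2l //; apply: (@le_lt_trans _ _ (m0 ^+ p)).
    rewrite foldX (le_trans (ler_norm _)) // normrX ler_pXn2r ?nnegrE ?(ltW m00) //.
    by move: hu; rewrite /near_pred subr0 => /ltW.
  by rewrite ltr_pXn2r ?nnegrE ?(ltW m00) //; lra.
have xw' : cw_hamiltonian p x < cw_hamiltonian p w :> R by rewrite ham_lt ?fw //; lra.
split=> z.
  move=> /(lt_mle ux xw') xz.
  have fz0 : 0 <= fold p (xbar z : R).
    (* A negative folded value occurs only for odd [p], and then the Hamiltonian of [z] is
       nonpositive. *)
    rewrite leNgt; apply/negP => fz0; move: xz; apply/negP; rewrite -leNgt !hamE.
    rewrite ler_wpM2l // (@le_trans _ _ 0) ?exprn_ge0 //.
    move: fz0; rewrite /fold; case: ifP => po; last by rewrite ltNge normr_ge0.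
    move=> z0; rewrite -[xbar z]opprK exprNn -signr_odd po mulN1r oppr_le0.
    by rewrite exprn_ge0 // oppr_ge0 ltW.
  rewrite ham_lt // in xz.
  have := hd (m1 - d); have fm : m1 - d <= fold p (xbar z) by lra.
  have := H_upper h0 (ltW dm0) fm.
  rewrite addrAC subrr add0r normrN gtr0_norm // ltr_norml => hz /(_ ltac:(lra)).
  lra.
rewrite /near_pred ltr_norml => hz.
have z0 : 0 <= xbar z :> R by lra.
have fz := fold_id p z0.
apply: (mle_lt ux xw' (v := w)); rewrite ham_lt ?fz ?fw //; lra.
Qed.

End Mle.

Theorem lemma5 (R : realType) (p : nat) (b0 b d : R)
    (hp : (3 <= p)%N) (hb0 : beta_star p < b0) (hb : b0 < b)
    (hd : 0 < d < 1) :
  (bahadur_slope (mple p) b0 b p = bahadur_slope (mle p) b0 b p <->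
     opt_sample_size (mple p) b0 b d p = opt_sample_size (mle p) b0 b d p) /\
  (bahadur_slope (mple p) b0 b p = bahadur_slope (mle p) b0 b p <->
     0 <= H b0 p (m_star b p)).
Proof.
split.
  rewrite /opt_sample_size; split => [->//|].
  (* After cancelling this factor, inversion is injective even at 0, where [0^-1 = 0]. *)
  have lnd : - 2 * ln d != 0.
    by rewrite mulf_neq0 ?oppr_eq0 ?pnatr_eq0 // lt_eqF // ln_lt0.
  by move/(mulfI lnd)/invr_inj.
have h0 := m_star_pos_max hp hb0.
have h1 := m_star_pos_max hp (lt_trans hb0 hb).
rewrite (bahadur_slopeE h0 h1 (tail_exponent_mple h0 h1 hb)).
rewrite (bahadur_slopeE h0 h1 (tail_exponent_mle h0 h1 hb)).
by have [Hm|Hm] := leP 0 (H b0 p (m_star b p)); split => //; lra.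
Qed.
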